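(* Let $V(\cdot)$ be the Maxwell operator pencil in $L^2(\Omega)^3\oplus L^2(\Omega)^3$ given by $$V(\omega)=\begin{pmatrix}-\mathrm{i}\sigma & \mathrm{i}\operatorname{curl}\\ -\mathrm{i}\operatorname{curl}_0 & 0\end{pmatrix}-\omega\begin{pmatrix}\varepsilon&0\\0&\mu\end{pmatrix},\qquad \operatorname{dom}V(\omega)=H_0(\operatorname{curl},\Omega)\oplus H(\operatorname{curl},\Omega),\quad\omega\in\mathbb{C}.$$ For $\omega\in\{z\in\mathbb{C}\setminus\mathrm{i}\mathbb{R}:\operatorname{Im}z<-\frac12\frac{\sigma_{\max}}{\varepsilon_{\min}}\}$, $$\|V(\omega)^{-1}\|\le\frac1{\min\{\varepsilon_{\min},\mu_{\min}\}}\,\frac1{|\operatorname{Im}\omega|-\frac12\frac{\sigma_{\max}}{\varepsilon_{\min}}}\left(1+\frac{\big(\frac12\frac{\sigma_{\max}}{\varepsilon_{\min}}\big)^2}{(\operatorname{Re}\omega)^2}\right),$$ and hence, for $\omega\in\{z\in\mathbb{C}:\operatorname{Im}z<-\frac{\sigma_{\max}}{\varepsilon_{\min}}\}$, $$\|V(\omega)^{-1}\|\le\frac1{\min\{\varepsilon_{\min},\mu_{\min}\}}\min\left\{\frac1{|\operatorname{Im}\omega|-\frac12\frac{\sigma_{\max}}{\varepsilon_{\min}}}\left(1+\frac{\big(\frac12\frac{\sigma_{\max}}{\varepsilon_{\min}}\big)^2}{(\operatorname{Re}\omega)^2}\right),\ \frac1{|\operatorname{Im}\omega|-\frac{\sigma_{\max}}{\varepsilon_{\min}}}\right\},$$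 where for $\operatorname{Re}\omega=0$ the first term in the minimum is read as $+\infty$.
   Context: $\Omega\subset\mathbb{R}^3$ is a (possibly unbounded) domain with Lipschitz boundary. The coefficients $\varepsilon,\mu,\sigma\in L^\infty(\Omega,\mathbb{R}^{3\times3})$ are symmetric, non-negative matrix-valued functions, and $\varepsilon_{\min},\varepsilon_{\max},\mu_{\min},\mu_{\max},\sigma_{\max}$ are constants such that a.e. in $\Omega$ and for all $\eta\in\mathbb{R}^3$, $|\eta|=1$: $0<\varepsilon_{\min}\le\eta\cdot\varepsilon\eta\le\varepsilon_{\max}$, $0<\mu_{\min}\le\eta\cdot\mu\eta\le\mu_{\max}$, $0\le\eta\cdot\sigma\eta\le\sigma_{\max}$. All function spaces are complex. $H(\operatorname{curl},\Omega)=\{u\in L^2(\Omega)^3:\operatorname{curl}u\in L^2(\Omega)^3\}$; $H_0(\operatorname{curl},\Omega)=\{u\in H(\operatorname{curl},\Omega):\nu\times u|_{\partial\Omega}=0\}$, with $\nu$ the outward unit normal. As operators in $L^2(\Omega)^3$, $\operatorname{curl}$ has domain $H(\operatorname{curl},\Omega)$ and $\operatorname{curl}_0=\operatorname{curl}^*$ acts as $\operatorname{curl}$ on domain $H_0(\operatorname{curl},\Omega)$. The claim includes that $V(\omega)$ is boundedly invertible for the stated $\omega$. *)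

(* Defs.v *)
From HB Require Import structures.
From mathcomp Require Import all_boot all_order all_algebra.
From mathcomp Require Import complex.
From mathcomp Require Import all_classical all_reals all_analysis.

Set Implicit Arguments.
Unset Strict Implicit.
Unset Printing Implicit Defensive.

Import Order.TTheory GRing.Theory Num.Theory.
Import numFieldNormedType.Exports.

Local Open Scope classical_set_scope.
Local Open Scope ring_scope.

(* Points of Euclidean 3-space.  R3 R carries the product topology; E3 R is the
   same type, seen as the product of the measurable types on which the library
   defines its Lebesgue measure (the Borel sigma-algebra). *)
Notation R3 R := (R * R * R)%type.
Notation E3 R := (measurableTypeR R * measurableTypeR R * measurableTypeR R)%type.

Notation leb3 R :=
  ((@lebesgue_measure R \x @lebesgue_measure R) \x @lebesgue_measure R)%E.

Notation CC3 R := 'cV[R[i]]_3.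

Section Defs.
Context {R : realType}.
Implicit Types (Omega : set (R3 R)) (A : R3 R -> 'M[R]_3).

Definition to_col (x : R3 R) : 'cV[R]_3 :=
  \col_(i < 3) nth 0 [:: x.1.1; x.1.2; x.2] i.

Definition axis (j : 'I_3) : R3 R :=
  ((j == 0)%:R, (j == 1)%:R, (j == 2)%:R).

(* Near every boundary point, Omega is, in suitable Cartesian coordinates
   y = Q x, the strict epigraph of a Lipschitz function of two variables. *)
Definition lipschitz_boundary Omega :=
  forall x, closure Omega x -> ~ interior Omega x ->
  exists (Q : 'M[R]_3) (g : R * R -> R) (L : R) (N : set (R3 R)),
    [/\ Q *m Q^T = 1%:M,
        (forall p q, `|g p - g q| <= L * `|p - q|),
        nbhs x N &
        forall y, N y ->
          let z := Q *m to_col y in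
          Omega y <-> g (z 0 0, z 1 0) < z 2 0].

Definition lipschitz_domain Omega :=
  [/\ open Omega, connected Omega, Omega !=set0 & lipschitz_boundary Omega].

Definition ae_in Omega (P : R3 R -> Prop) :=
  {ae leb3 R, forall x : E3 R, Omega x -> P x}.

Definition measurable_in Omega (f : R3 R -> R) :=
  @measurable_fun _ _ (E3 R) (measurableTypeR R) Omega f.

Definition Linfty_mx Omega A :=
  (forall i j, measurable_in Omega (fun x => A x i j)) /\
  exists M : R, ae_in Omega (fun x => forall i j, `|A x i j| <= M).

Definition symmetric_in Omega A := ae_in Omega (fun x => (A x)^T = A x).

Definition form_bounds Omega A (lo hi : R) :=
  ae_in Omega (fun x => forall eta : 'cV[R]_3,
    \sum_(i < 3) eta i 0 ^+ 2 = 1 ->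
    lo <= (eta^T *m A x *m eta) 0 0 <= hi).

Definition field := R3 R -> CC3 R.
Implicit Types (u v w z : field).

Definition sqnorm (a : CC3 R) : R :=
  \sum_(i < 3) (complex.Re (a i 0) ^+ 2 + complex.Im (a i 0) ^+ 2).

Definition dotC (a b : CC3 R) : R[i] := \sum_(i < 3) a i 0 * (b i 0)^*.

Definition L2 Omega u :=
  (forall i, measurable_in Omega (fun x => complex.Re (u x i 0)) /\
             measurable_in Omega (fun x => complex.Im (u x i 0))) /\
  (\int[leb3 R]_(x in Omega) (sqnorm (u x))%:E < +oo)%E.

Definition ip Omega u v : R[i] :=
  Complex (\int[leb3 R]_(x in Omega) complex.Re (dotC (u x) (v x)))
          (\int[leb3 R]_(x in Omega) complex.Im (dotC (u x) (v x))).

Definition partial (j : 'I_3) (f : R3 R -> R) : R3 R -> R :=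
  fun x => 'D_(axis j) f x.

Definition smooth (f : R3 R -> R) := forall s : seq 'I_3,
  continuous (foldr partial f s) /\
  forall j x, derivable (foldr partial f s) x (axis j).

(* real vector fields of class C^infty with compact support in Omega *)
Definition test_field Omega (phi : R3 R -> 'cV[R]_3) :=
  [/\ forall i, smooth (fun x => phi x i 0),
      compact (closure [set x | phi x != 0]) &
      closure [set x | phi x != 0] `<=` Omega].

(* Indices are added modulo 3. *)
Definition classical_curl (phi : R3 R -> 'cV[R]_3) (x : R3 R) : 'cV[R]_3 :=
  \col_(i < 3) (partial (i + 1) (fun y => phi y (i + 2) 0) x
              - partial (i + 2) (fun y => phi y (i + 1) 0) x).

Definition complexify (phi : R3 R -> 'cV[R]_3) : field :=
  fun x => map_mx (real_complex R) (phi x).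

(* u is in H(curl, Omega) and w = curl u, in the sense of distributions *)
Definition is_curl Omega u w :=
  [/\ L2 Omega u, L2 Omega w &
      forall phi, test_field Omega phi ->
        ip Omega w (complexify phi) =
        ip Omega u (complexify (classical_curl phi))].

(* For u in H(curl, Omega) with curl u = w, the tangential trace nu x u on the
   boundary is the functional v |-> (curl u, v) - (u, curl v) on H(curl, Omega)
   (Green's formula for the curl).  Testing against all of H(curl, Omega) makes
   curl_0 the adjoint of curl. *)
Definition tangential_trace_zero Omega u w :=
  forall v z, is_curl Omega v z -> ip Omega w v - ip Omega u z = 0.

(* u is in H_0(curl, Omega) and w = curl u *)
Definition is_curl0 Omega u w :=
  is_curl Omega u w /\ tangential_trace_zero Omega u w.

(* Elements of L^2 are represented by functions, and operators by their graphs,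
   a graph G U F meaning that U is in the domain and is mapped to F;
   equality of elements is equality almost everywhere in Omega. *)
Definition state := (field * field)%type.
Implicit Types (U F : state) (G : state -> state -> Prop).

Definition L2_state Omega U := L2 Omega U.1 /\ L2 Omega U.2.

Definition eq_state Omega U U' :=
  ae_in Omega (fun x => U.1 x = U'.1 x /\ U.2 x = U'.2 x).

Definition norm_state Omega U : R :=
  Num.sqrt (\int[leb3 R]_(x in Omega) (sqnorm (U.1 x) + sqnorm (U.2 x))).

(* the operator norm of the inverse of the operator with graph G *)
Definition norm_inv Omega G : \bar R :=
  ereal_sup [set y | exists U F,
    [/\ G U F, norm_state Omega F <= 1 & y = (norm_state Omega U)%:E]].

Definition boundedly_invertible Omega G :=
  [/\ forall F, L2_state Omega F -> exists U, G U F,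
      forall U U' F, G U F -> G U' F -> eq_state Omega U U' &
      (norm_inv Omega G < +oo)%E].

Definition mul_field A u : field :=
  fun x => map_mx (real_complex R) (A x) *m u x.

(* the graph of V(omega): V(omega) (u, v) = (f, g) *)
Definition maxwell Omega (eps mu sigma : R3 R -> 'M[R]_3) (omega : R[i])
    U F : Prop :=
  L2_state Omega F /\
  exists curlu curlv,
    [/\ is_curl0 Omega U.1 curlu, is_curl Omega U.2 curlv &
        ae_in Omega (fun x =>
          F.1 x = - 'i *: mul_field sigma U.1 x + 'i *: curlv x
                  - omega *: mul_field eps U.1 x /\
          F.2 x = - 'i *: curlu x - omega *: mul_field mu U.2 x)].

End Defs.

(* Main.v *)
Require Import Defs.
From HB Require Import structures.
From mathcomp Require Import all_boot all_order all_algebra.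
From mathcomp Require Import complex.
From mathcomp Require Import all_classical all_reals all_analysis.
From mathcomp Require Import measurable_realfun.
From mathcomp Require Import ring lra.

Set Implicit Arguments.
Unset Strict Implicit.
Unset Printing Implicit Defensive.

Import Order.TTheory GRing.Theory Num.Theory.
Import numFieldNormedType.Exports.

Local Open Scope classical_set_scope.
Local Open Scope ring_scope.

(** Write V(omega)(u, v) = (f, g) as
      f = i z - i sigma u - omega eps u,     g = - i w - omega mu v,
    with w = curl_0 u and z = curl v, and put N_u = (eps u, u),
    N_v = (mu v, v), s = (sigma u, u).  As curl_0 is the adjoint of curl,
    (w, v) is the complex conjugate of (z, u); hence i (z, u) - i (w, v) is
    real and i (z, u) + i (w, v) is imaginary, so that the curls disappear
    from both of
      Im ((f, u) + (g, v)) = - s - Im omega (N_u + N_v),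
      Re ((f, u) - (g, v)) = - Re omega (N_u - N_v)
    ([energy_identities]).  With kappa = sigma_max / eps_min one has
    0 <= s <= kappa N_u.  Let Im omega < 0.  Bounding N_u by N_u + N_v in
    the first identity gives
      (|Im omega| - kappa) (N_u + N_v) <= Im ((f, u) + (g, v)),
    the numerical range estimate.  The better half-plane comes from
      kappa N_u = kappa / 2 (N_u + N_v) + kappa / 2 (N_u - N_v),
    where the second identity turns the last difference into data, at the price
    of the factor t = kappa / (2 Re omega):
      (|Im omega| - kappa / 2) (N_u + N_v)
        <= Im ((f, u) + (g, v)) - t Re ((f, u) - (g, v)).
    The right-hand side is the real part of the inner product of (f, g) with
    (- t + i) u and (t + i) v, so it is at most sqrt (1 + t^2) |(f, g)| |(u, v)|
    ([pencil_bound]).  Finally N_u + N_v >= min(eps_min, mu_min) |(u, v)|^2, and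
    sqrt (1 + t^2) <= 1 + t^2.

    The estimate makes V(omega) injective.  It also makes the range closed,
    because the graph of V(omega) is closed ([maxwell_closed]) and L^2 is
    complete ([riesz_fischer], [sip_complete_L2]), so that the right-hand side
    can be projected onto the range ([range_projection]).  What is left of it is
    orthogonal to the range, and vanishes by a symmetry of the pencil: if (p, q)
    is orthogonal to the range, then (conj p, - conj q) lies in the kernel of
    V(omega) itself ([range_complement]), hence is zero.  This last step uses
    that the adjoint of curl_0 is curl again, that is, that smooth compactly
    supported fields belong to the domain of curl_0 ([is_curl0_test]); this is
    integration by parts ([integration_by_parts3]), proved from Fubini's theorem
    and the fundamental theorem of calculus. *)

(** * Lebesgue measure on three-dimensional space *)

Section Measure3.
Context {R : realType}.
Notation E1 := (measurableTypeR R).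
Notation E2 := (E1 * E1)%type.

Definition leb1 : {sigma_finite_measure set E1 -> \bar R} := @lebesgue_measure R.

Let sigma_finite_leb2 : sigma_finite setT (leb1 \x leb1)%E.
Proof.
have /sigma_finiteP[F [TF ndF Foo]] := sigma_finiteT leb1.
exists (fun n => F n `*` F n).
  rewrite -setXTT TF predeqE => -[x y]; split.
    move=> [/= [n _ Fnx] [k _ Fky]]; exists (maxn n k) => //; split.
    - by move: x Fnx; exact/subsetPset/ndF/leq_maxl.
    - by move: y Fky; exact/subsetPset/ndF/leq_maxr.
  by move=> [n _ []/= ? ?]; split; exists n.
move=> k; have [? ?] := Foo k; split; first exact: measurableX.
by rewrite product_measure1E// lte_mul_pinfty// ge0_fin_numE.
Qed.

(** Lebesgue measure on the plane, declared sigma-finite so that it can be a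
    factor in Fubini's theorem. *)
Definition leb2 : set E2 -> \bar R := (leb1 \x leb1)%E.

HB.instance Definition _ := Measure.copy leb2 (leb1 \x leb1)%E.
HB.instance Definition _ :=
  Measure_isSigmaFinite.Build _ _ _ leb2 sigma_finite_leb2.

(** The measure leb3, seen as a product of two sigma-finite factors. *)
Definition mu3 : {measure set (E3 R) -> \bar R} := (leb2 \x leb1)%E.

Let box (k : rat * rat * rat * rat) : set (R3 R) :=
  ball (ratr k.1.1.1 : R) (ratr k.2) `*` ball (ratr k.1.1.2 : R) (ratr k.2)
  `*` ball (ratr k.1.2 : R) (ratr k.2).

Lemma measurable_box (a b c e : R) :
  measurable (ball a e `*` ball b e `*` ball c e : set (E3 R)).
Proof.
by apply: measurableX; [apply: measurableX|];
  apply: open_measurable; apply: ball_open.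
Qed.

Lemma rat_ball (x e : R) : 0 < e -> exists q : rat, ball x e (ratr q : R).
Proof.
move=> e0.
have [q] := @rat_in_itvoo R (x - e) (x + e) ltac:(lra).
rewrite in_itv /= => /andP[h1 h2]; exists q.
by rewrite /ball /= ltr_distlC h1.
Qed.

(** An open set is the union of the cubes with rational centre and rational
    radius that it contains. *)
Lemma open_measurable3 (U : set (R3 R)) : open U -> measurable (U : set (E3 R)).
Proof.
move=> oU.
have -> : U = \bigcup_(k in [set k | box k `<=` U]) box k.
  rewrite eqEsubset; split => [x Ux|x [k kU]]; last exact: kU.
  have /nbhs_ballP[e /= e0 eU] := oU _ Ux.
  have [r] := @rat_in_itvoo R 0 (e / 2) ltac:(lra).
  rewrite in_itv /= => /andP[r0 re].
  have [a ha] := rat_ball x.1.1 r0.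
  have [b hb] := rat_ball x.1.2 r0.
  have [c hc] := rat_ball x.2 r0.
  have H (t s u : R) : ball t (ratr r) s -> ball s (ratr r) u -> ball t e u.
    move=> ts su; apply: (@le_ball _ _ _ (ratr r + ratr r)); first by lra.
    exact: ball_triangle ts su.
  exists (a, b, c, r); last by split; [split|]; exact: ball_sym.
  move=> [[y1 y2] y3] [[/= h1 h2] h3]; apply: eU.
  by split; [split|]; apply: H; eassumption.
rewrite bigcup_mkcond; apply: countable_bigcupT_measurable => [|k]; first exact: countableP.
by case: ifPn => // _; apply: measurable_box.
Qed.

Lemma continuous_measurable3 (f : R3 R -> R) :
  continuous f -> measurable_fun setT (f : E3 R -> R).
Proof.
move=> /continuousP cf; apply: (measurability _ (RGenOpens.measurableE R)).
move=> _ [_ [a [b ->] <-]]; rewrite setTI; apply: open_measurable3.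
exact/cf/interval_open.
Qed.

Lemma mu3X (A B C : set E1) : measurable A -> measurable B -> measurable C ->
  mu3 (A `*` B `*` C) = (leb1 A * leb1 B * leb1 C)%E.
Proof.
move=> mA mB mC; transitivity (leb2 (A `*` B) * leb1 C)%E.
  by apply: (product_measure1E leb2 leb1) => //; apply: measurableX.
by congr (_ * _)%E; apply: (product_measure1E leb1 leb1).
Qed.

Lemma open_leb3_gt0 (U : set (R3 R)) : open U -> U !=set0 -> (0 < mu3 U)%E.
Proof.
move=> oU [x Ux]; have /nbhs_ballP[e /= e0 eU] := oU _ Ux.
apply: (@lt_le_trans _ _ (mu3 (ball x.1.1 e `*` ball x.1.2 e `*` ball x.2 e))).
  rewrite mu3X; [|by apply: open_measurable; apply: ball_open..].
  have lb (t : R) : leb1 (ball t e) = (e *+ 2)%:E.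
    exact: (lebesgue_measure_ball t (ltW e0)).
  by rewrite !lb -!EFinM lte_fin !mulr_gt0 // mulr2n addr_gt0.
apply: le_measure; rewrite ?inE.
- exact: measurable_box.
- exact: open_measurable3.
- by move=> [[y1 y2] y3] [[/= h1 h2] h3]; apply: eU; split.
Qed.

(** A nonempty open set is not negligible, so properties that hold almost
    everywhere on it do hold somewhere. *)
Lemma ae_in_witness (U : set (R3 R)) (P : R3 R -> Prop) :
  open U -> U !=set0 -> ae_in U P -> exists x, U x /\ P x.
Proof.
move=> oU U0 [N [mN N0 UN]].
apply: contrapT => /forallNP nP.
suff : (mu3 U <= mu3 N)%E.
  by rewrite [X in (_ <= X)%E](N0 : mu3 N = 0%E) leNgt open_leb3_gt0.
apply: le_measure; rewrite ?inE//; first exact: open_measurable3.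
by move=> x Ux; apply: UN => /= /(_ Ux) Px; apply: (nP x).
Qed.

Lemma bounded_integrable d (T : measurableType d) (m : {measure set T -> \bar R})
    (A : set T) (f : T -> R) (K : R) :
  measurable A -> (m A < +oo)%E -> measurable_fun setT f ->
  (forall x, `|f x| <= K) -> (forall x, ~ A x -> f x = 0) ->
  m.-integrable setT (EFin \o f).
Proof.
move=> mA Aoo mf fK fA.
have -> : EFin \o f = (EFin \o f) \_ A.
  apply/funext => x; rewrite patchE; case: ifPn => //.
  by rewrite notin_setE => /fA /= ->.
apply/(integrable_mkcond (EFin \o f) mA).
apply: (@measurable_bounded_integrable _ T R m f A mA) => //; first exact: measurable_funTS.
exists K; split => [|M KM]; first exact: num_real.
by move=> x _ /=; apply: le_trans (fK x) (ltW KM).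
Qed.

End Measure3.

(** * Integration by parts for compactly supported functions *)

Section IntegrationByParts.
Context {R : realType}.
Notation E1 := (measurableTypeR R).
Notation E2 := (E1 * E1)%type.
Implicit Types (h f g : R3 R -> R) (K : set (R3 R)).

(** The fundamental theorem of calculus on an interval whose end points lie
    outside the support. *)
Lemma integral_derivative_compact_support (g g' : R -> R) (M : R) :
  0 < M -> (forall t, is_derive t (1 : R) g (g' t)) -> continuous g' ->
  (forall t, M <= `|t| -> g t = 0) -> (forall t, M <= `|t| -> g' t = 0) ->
  (\int[leb1]_t (g' t)%:E = 0)%E.
Proof.
move=> M0 dg cg' g0 g'0.
have dgt t : derivable g t 1 by case: (dg t).
have cg : continuous g.
  by move=> t; apply: differentiable_continuous; exact/derivable1_diffP.
have -> : (fun t => (g' t)%:E) = (fun t => (g' t)%:E) \_ `[- M, M].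
  apply/funext => t; rewrite patchE; case: ifPn => //.
  rewrite notin_setE /= in_itv /= => tM; rewrite g'0 //.
  by rewrite leNgt ltr_norml; apply/negP => /andP[h1 h2]; apply: tM; rewrite !ltW.
rewrite -integral_mkcond [LHS](@continuous_FTC2 R g' g).
- by rewrite !g0 ?normrN ?ger0_norm ?(ltW M0) // -EFinB subrr.
- by lra.
- exact: continuous_subspaceT.
- split; first by move=> t _; exact: dgt.
  + exact/cvg_at_right_filter/cg.
  + exact/cvg_at_left_filter/cg.
- by move=> t _; rewrite derive1E; apply: derive_val.
Qed.

Definition set_coord (j : 'I_3) (x : R3 R) (t : R) : R3 R :=
  (if j == 0 then t else x.1.1, if j == 1 then t else x.1.2,
   if j == 2 then t else x.2).

Definition coord (j : 'I_3) (x : R3 R) : R :=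
  if j == 0 then x.1.1 else if j == 1 then x.1.2 else x.2.

Lemma ord3_ind (P : 'I_3 -> Prop) : P 0 -> P 1 -> P 2 -> forall j, P j.
Proof.
move=> P0 P1 P2 [[|[|[|//]]] jlt].
- by rewrite (_ : Ordinal jlt = 0) //; apply: val_inj.
- by rewrite (_ : Ordinal jlt = 1) //; apply: val_inj.
- by rewrite (_ : Ordinal jlt = 2) //; apply: val_inj.
Qed.

Lemma set_coordD j x (t s : R) : s *: axis j + set_coord j x t = set_coord j x (s + t).
Proof.
by elim/ord3_ind: j; rewrite /set_coord /axis /=; congr (_, _, _) => /=;
  rewrite /GRing.scale /= ?mulr1 ?mulr0 ?add0r.
Qed.

(** Reduces directional derivatives along an axis to derivatives in one real
    variable: the difference quotients coincide. *)
Lemma is_derive_set_coord h j x (t : R) :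
  (forall y, derivable h y (axis j)) ->
  is_derive t (1 : R) (fun s => h (set_coord j x s)) (partial j h (set_coord j x t)).
Proof.
move=> dh.
have E : (fun s : R => s^-1 *: (((fun s => h (set_coord j x s)) \o shift t) (s *: 1)
            - (fun s => h (set_coord j x s)) t)) =
         (fun s : R => s^-1 *: ((h \o shift (set_coord j x t)) (s *: axis j)
            - h (set_coord j x t))).
  by apply/funext => s /=; rewrite set_coordD /GRing.scale /= mulr1.
split; first by rewrite /derivable E; exact: dh.
by rewrite /partial /derive E.
Qed.

Lemma compact_box K : compact K ->
  exists2 M : R, 0 < M & forall x j, K x -> `|coord j x| < M.
Proof.
move=> /compact_bounded [M [_ HM]].
exists (`|M| + 2); first by rewrite ltr_wpDl.
move=> x j Kx; have := HM (`|M| + 1) _ x Kx.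
rewrite (le_lt_trans (ler_norm M)) ?ltrDl // => /(_ isT) xM.
apply: (@le_lt_trans _ _ (`|M| + 1)); last by lra.
apply: le_trans xM.
case: x {Kx} => [[x1 x2] x3].
have -> : `|((x1, x2), x3)| = Num.max (Num.max `|x1| `|x2|) `|x3| by [].
by rewrite !le_max; elim/ord3_ind: j; rewrite /coord /= lexx ?orbT.
Qed.

Lemma compact_support_bounded K f : compact K -> continuous f ->
  (forall x, ~ K x -> f x = 0) -> exists B : R, forall x, `|f x| <= B.
Proof.
move=> cK cf f0.
have /compact_bounded [M [_ HM]] : compact (f @` K).
  by apply: continuous_compact => //; exact: continuous_subspaceT.
exists (`|M| + 1) => x; have [Kx|nKx] := pselect (K x).
  by apply: HM; [rewrite (le_lt_trans (ler_norm M)) // ltrDl|exists x].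
by rewrite f0 // normr0 addr_ge0.
Qed.

Lemma partial_support K h j : compact K -> (forall x, ~ K x -> h x = 0) ->
  forall x, ~ K x -> partial j h x = 0.
Proof.
move=> cK h0 x nKx; rewrite /partial.
have cl : closed K by apply: compact_closed.
rewrite (@near_eq_derive _ _ _ h (cst 0)) ?derive_cst //.
apply: filterS (open_nbhs_nbhs _) => [y|]; first exact: h0.
by split => //; apply: closed_openC.
Qed.

Lemma compact_support_integrable K f : compact K -> continuous f ->
  (forall x, ~ K x -> f x = 0) -> mu3.-integrable setT (EFin \o (f : E3 R -> R)).
Proof.
move=> cK cf f0.
have [M M0 KM] := compact_box cK.
have [B fB] := compact_support_bounded cK cf f0.
have lb : leb1 (ball (0 : R) M) = (M *+ 2)%:E.
  exact: (lebesgue_measure_ball _ (ltW M0)).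
apply: (@bounded_integrable R _ (E3 R) mu3 (ball (0:R) M `*` ball (0:R) M `*` ball (0:R) M) f B).
- exact: measurable_box.
- rewrite mu3X; [|by apply: open_measurable; apply: ball_open..].
  by rewrite !lb -!EFinM ltry.
- exact: continuous_measurable3.
- exact: fB.
- move=> x nx; apply: f0 => Kx; apply: nx.
  rewrite /ball /=; split; [split|]; rewrite /ball /= sub0r normrN.
  + exact: (KM _ 0 Kx).
  + exact: (KM _ 1 Kx).
  + exact: (KM _ 2 Kx).
Qed.

Lemma continuous_set_coord j x : continuous (set_coord j x).
Proof.
have c (b : bool) (a : R) : continuous (fun t : R => if b then t else a).
  by case: b => t; [exact: cvg_id|exact: cvg_cst].
by move=> t; exact: (cvg_pair (cvg_pair (c _ _ t) (c _ _ t)) (c _ _ t)).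
Qed.

Lemma integral_partial_line h j K x : compact K -> continuous (partial j h) ->
  (forall y, derivable h y (axis j)) -> (forall y, ~ K y -> h y = 0) ->
  (\int[leb1]_t (partial j h (set_coord j x t))%:E = 0)%E.
Proof.
move=> cK ch dh h0; have [M M0 KM] := compact_box cK.
have cu t : coord j (set_coord j x t) = t by elim/ord3_ind: (j).
have out t : M <= `|t| -> ~ K (set_coord j x t).
  by move=> Mt /(KM _ j); rewrite cu ltNge Mt.
apply: (@integral_derivative_compact_support (fun t => h (set_coord j x t)) _ M) => //.
- by move=> t; apply: is_derive_set_coord.
- by move=> t; apply: continuous_comp; [exact: continuous_set_coord|exact: ch].
- by move=> t /out; exact: h0.
- by move=> t /out; apply: partial_support h0 _.
Qed.

Lemma integrable_slice K f (z : R) : compact K -> continuous f ->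
  (forall x, ~ K x -> f x = 0) ->
  (leb1 \x leb1)%E.-integrable setT (fun p : E2 => (f (p, z))%:E).
Proof.
move=> cK cf f0.
have [M M0 KM] := compact_box cK.
have [B fB] := compact_support_bounded cK cf f0.
have lb : leb1 (ball (0 : R) M) = (M *+ 2)%:E.
  exact: (lebesgue_measure_ball _ (ltW M0)).
have mb : measurable (ball (0:R) M : set E1).
  by apply: open_measurable; apply: ball_open.
apply: (@bounded_integrable R _ E2 (leb1 \x leb1)%E (ball (0:R) M `*` ball (0:R) M) (fun p => f (p, z)) B).
- exact: measurableX.
- rewrite [X in (X < _)%E](_ : _ = (leb1 (ball (0%R:R) M) * leb1 (ball (0%R:R) M))%E).
    by rewrite !lb -EFinM ltry.
  exact: (product_measure1E leb1 leb1).
- have m1 : measurable_fun setT (fun p : E2 => p) by exact: measurable_id.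
  have m2 : measurable_fun setT (fun _ : E2 => z : E1) by exact: measurable_cst.
  exact: (measurableT_comp (continuous_measurable3 cf) (measurable_fun_pair m1 m2)).
- by move=> p; exact: fB.
- move=> p np; apply: f0 => Kx; apply: np.
  rewrite /ball /=; split; rewrite /ball /= sub0r normrN.
  + exact: (KM _ 0 Kx).
  + exact: (KM _ 1 Kx).
Qed.

(** Fubini's theorem, with the integral along the axis j taken innermost: each
    line integral vanishes.  The measure is the product (x, y) with z, so the
    axes x and y need a second application, on horizontal slices. *)
Lemma integral_partial h j K : compact K -> continuous (partial j h) ->
  (forall y, derivable h y (axis j)) -> (forall y, ~ K y -> h y = 0) ->
  (\int[mu3]_x (partial j h x)%:E = 0)%E.
Proof.
move=> cK ch dh h0.
have line := integral_partial_line _ cK ch dh h0.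
have ph0 := partial_support j cK h0.
have int3 := compact_support_integrable cK ch ph0.
have int2 z := integrable_slice z cK ch ph0.
have [j2|j2] := eqVneq j 2; last first.
  transitivity (\int[leb1]_z (\int[leb2]_p (partial j h (p, z))%:E))%E.
    by rewrite -[LHS](integral21_prod_meas1 (m1 := leb2) (m2 := leb1) int3).
  apply: integral0_eq => z _.
  have [j1|j1] := eqVneq j 1.
    rewrite -[LHS](integral12_prod_meas1 (m1 := leb1) (m2 := leb1) (int2 z)).
    apply: integral0_eq => x _; rewrite /fubini_F /=.
    rewrite -[RHS](line (x, 0, z)).
    by rewrite j1.
  have j0 : j = 0 by move: j1 j2; elim/ord3_ind: (j).
  rewrite -[LHS](integral21_prod_meas1 (m1 := leb1) (m2 := leb1) (int2 z)).
  apply: integral0_eq => x _; rewrite /fubini_G /=.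
  rewrite -[RHS](line (0, x, z)).
  by rewrite j0.
rewrite -[LHS](integral12_prod_meas1 (m1 := leb2) (m2 := leb1) int3).
apply: integral0_eq => p _; rewrite /fubini_F /=.
rewrite -[RHS](line (p, 0)) j2.
by case: p.
Qed.

(** The product f g has compact support inside U, so its partial derivative
    may be integrated over the whole space, where the integral is zero. *)
Lemma integration_by_parts3 (U K : set (R3 R)) f g j :
  measurable (U : set (E3 R)) -> compact K -> K `<=` U ->
  continuous f -> continuous g -> continuous (partial j f) ->
  continuous (partial j g) ->
  (forall x, derivable f x (axis j)) -> (forall x, derivable g x (axis j)) ->
  (forall x, ~ K x -> f x = 0) -> (forall x, ~ K x -> g x = 0) ->
  \int[mu3]_(x in U) (partial j f x * g x) =
  - \int[mu3]_(x in U) (f x * partial j g x).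
Proof.
move=> mU cK KU cf cg cf' cg' df dg f0 g0.
have cM (a b : R3 R -> R) : continuous a -> continuous b ->
  continuous (fun x => a x * b x) by move=> ca cb x; exact: cvgM (ca x) (cb x).
have ph (x : R3 R) : partial j (fun x => f x * g x) x =
    partial j f x * g x + f x * partial j g x.
  by rewrite /partial (deriveM (df x) (dg x)) /GRing.scale /= addrC [g x * _]mulrC.
have ph' : partial j (fun x => f x * g x) =
    fun x => partial j f x * g x + f x * partial j g x by exact/funext.
have int0 : (\int[mu3]_x (partial j (fun x => f x * g x)%R x)%:E = 0)%E.
  apply: (@integral_partial (fun x => f x * g x) j K cK).
  - by rewrite ph' => x; exact: cvgD (cM _ _ cf' cg x) (cM _ _ cf cg' x).
  - by move=> y; exact: derivableM (df y) (dg y).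
  - by move=> y /f0 ->; rewrite mul0r.
have intU (a b : R3 R -> R) : continuous a -> continuous b -> (forall x, ~ K x -> a x = 0) ->
    mu3.-integrable U (EFin \o (fun x : E3 R => a x * b x)).
  move=> ca cb a0; apply: (@integrableS _ _ _ _ setT) => //.
  apply: (@compact_support_integrable K (fun x => a x * b x)) => //.
    exact: cM.
  by move=> x /a0 ->; rewrite mul0r.
apply/eqP; rewrite -addr_eq0 -RintegralD //; last 2 first.
  by apply: intU => //; exact: partial_support.
  by apply: intU.
apply/eqP; rewrite Rintegral_mkcond -[RHS](congr1 fine int0).
congr fine; apply: eq_integral => x _; rewrite patchE; case: ifPn => [_|].
  by rewrite ph.
rewrite notin_setE => nU; rewrite ph.
have nK : ~ K x by move/KU.
by rewrite f0 // g0 // mulr0 mul0r addr0.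
Qed.

End IntegrationByParts.

(** * Real and imaginary parts *)

Section ComplexParts.
Context {R : rcfType}.
Implicit Types a b : R[i].

Lemma cRe_add a b : complex.Re (a + b) = complex.Re a + complex.Re b.
Proof. by case: a; case: b. Qed.
Lemma cIm_add a b : complex.Im (a + b) = complex.Im a + complex.Im b.
Proof. by case: a; case: b. Qed.
Lemma cRe_opp a : complex.Re (- a) = - complex.Re a.
Proof. by case: a. Qed.
Lemma cIm_opp a : complex.Im (- a) = - complex.Im a.
Proof. by case: a. Qed.
Lemma cRe_mul a b :
  complex.Re (a * b) = complex.Re a * complex.Re b - complex.Im a * complex.Im b.
Proof. by case: a; case: b. Qed.
Lemma cIm_mul a b :
  complex.Im (a * b) = complex.Re a * complex.Im b + complex.Im a * complex.Re b.
Proof. by case: a; case: b. Qed.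
Lemma cRe_conj a : complex.Re a^* = complex.Re a.
Proof. by case: a. Qed.
Lemma cIm_conj a : complex.Im a^* = - complex.Im a.
Proof. by case: a. Qed.
Lemma cRe_i : complex.Re ('i : R[i]) = 0. Proof. by []. Qed.
Lemma cIm_i : complex.Im ('i : R[i]) = 1. Proof. by []. Qed.
Lemma cRe_real (x : R) : complex.Re x%:C%C = x. Proof. by []. Qed.
Lemma cIm_real (x : R) : complex.Im x%:C%C = 0. Proof. by []. Qed.
Lemma cRe_0 : complex.Re (0 : R[i]) = 0. Proof. by []. Qed.
Lemma cIm_0 : complex.Im (0 : R[i]) = 0. Proof. by []. Qed.
Lemma cRe_1 : complex.Re (1 : R[i]) = 1. Proof. by []. Qed.
Lemma cIm_1 : complex.Im (1 : R[i]) = 0. Proof. by []. Qed.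

Lemma complex_ext a b :
  complex.Re a = complex.Re b -> complex.Im a = complex.Im b -> a = b.
Proof. by case: a b => [? ?] [? ?] /= -> ->. Qed.

Definition ReImE := (cRe_add, cIm_add, cRe_opp, cIm_opp, cRe_mul, cIm_mul, cRe_conj, cIm_conj,
  cRe_i, cIm_i, cRe_real, cIm_real, cRe_0, cIm_0, cRe_1, cIm_1).

Lemma i_sqr : 'i * 'i = -1 :> R[i].
Proof. by apply: complex_ext; rewrite !ReImE; ring. Qed.

End ComplexParts.

(** * Semi-inner product spaces *)

Section SemiInnerProduct.
Context {R : realType} {H : lmodType R[i]}.
Variables (dom : H -> Prop) (sp : H -> H -> R[i]).

(** Elements of L^2 are functions, not classes of functions, and fields
    outside L^2 have no norm: hence a positive semidefinite form, and a domain. *)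
Record semi_inner_product : Prop := SemiInnerProduct {
  sip_dom0 : dom 0;
  sip_domD : forall x y, dom x -> dom y -> dom (x + y);
  sip_domZ : forall (c : R[i]) x, dom x -> dom (c *: x);
  sip_Dl : forall x y z, dom x -> dom y -> dom z -> sp (x + y) z = sp x z + sp y z;
  sip_Zl : forall (c : R[i]) x y, dom x -> dom y -> sp (c *: x) y = c * sp x y;
  sip_conj : forall x y, dom x -> dom y -> sp y x = (sp x y)^*;
  sip_ge0 : forall x, dom x -> 0 <= complex.Re (sp x x)
}.

Hypothesis S : semi_inner_product.
Let domD := sip_domD S.
Let domZ := sip_domZ S.

(** The squared seminorm. *)
Definition nq x : R := complex.Re (sp x x).

Lemma sip_domN x : dom x -> dom (- x).
Proof. by rewrite -scaleN1r; exact: domZ. Qed.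

Lemma sip_domB x y : dom x -> dom y -> dom (x - y).
Proof. by move=> dx dy; apply: domD => //; exact: sip_domN. Qed.

Lemma sip_Nl x y : dom x -> dom y -> sp (- x) y = - sp x y.
Proof. by move=> dx dy; rewrite -scaleN1r (sip_Zl S) // mulN1r. Qed.

Lemma sip_Dr x y z : dom x -> dom y -> dom z -> sp x (y + z) = sp x y + sp x z.
Proof.
move=> dx dy dz; rewrite (sip_conj S) ?(sip_Dl S) ?rmorphD //; last exact: domD.
by rewrite /= -!(sip_conj S).
Qed.

Lemma sip_Zr (c : R[i]) x y : dom x -> dom y -> sp x (c *: y) = c^* * sp x y.
Proof.
move=> dx dy; rewrite (sip_conj S) ?(sip_Zl S) ?rmorphM //; last exact: domZ.
by rewrite /= -(sip_conj S).
Qed.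

Lemma sip_Nr x y : dom x -> dom y -> sp x (- y) = - sp x y.
Proof. by move=> dx dy; rewrite -scaleN1r sip_Zr // rmorphN1 mulN1r. Qed.

Lemma sip_Bl x y z : dom x -> dom y -> dom z -> sp (x - y) z = sp x z - sp y z.
Proof.
by move=> dx dy dz; rewrite (sip_Dl S) ?sip_Nl //; exact: sip_domN.
Qed.

Lemma Re_sip_sym x y : dom x -> dom y -> complex.Re (sp y x) = complex.Re (sp x y).
Proof. by move=> dx dy; rewrite (sip_conj S) // cRe_conj. Qed.

Lemma Im_sip_self x : dom x -> complex.Im (sp x x) = 0.
Proof.
move=> dx; have := congr1 (@complex.Im R) (sip_conj S dx dx).
by rewrite cIm_conj; lra.
Qed.

Lemma nq_ge0 x : dom x -> 0 <= nq x.
Proof. exact: sip_ge0. Qed.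

Lemma nqD x y : dom x -> dom y ->
  nq (x + y) = nq x + nq y + 2 * complex.Re (sp x y).
Proof.
move=> dx dy; rewrite /nq (sip_Dl S) ?sip_Dr ?ReImE //; try exact: domD.
by rewrite (Re_sip_sym dx dy); lra.
Qed.

Lemma nqZ (c : R[i]) x : dom x ->
  nq (c *: x) = (complex.Re c ^+ 2 + complex.Im c ^+ 2) * nq x.
Proof.
move=> dx; rewrite /nq (sip_Zl S) ?sip_Zr ?ReImE ?(Im_sip_self dx) //; last exact: domZ.
by rewrite ?ReImE; ring.
Qed.

Lemma nqN x : dom x -> nq (- x) = nq x.
Proof. by move=> dx; rewrite /nq sip_Nl ?sip_Nr ?opprK //; exact: sip_domN. Qed.

Lemma nq_sum_le x y : dom x -> dom y -> nq (x + y) <= 2 * (nq x + nq y).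
Proof.
move=> dx dy; have := nq_ge0 (sip_domB dx dy).
rewrite !nqD ?nqN ?sip_Nr ?ReImE //; last exact: sip_domN.
by lra.
Qed.

Lemma nqZr (t : R) x : dom x -> nq (t%:C%C *: x) = t ^+ 2 * nq x.
Proof. by move=> dx; rewrite nqZ // !ReImE; ring. Qed.

(** Nonnegativity of the square of x + t y, at the minimising t when y has
    positive norm, and at a t making it negative otherwise. *)
Lemma cauchy_schwarz x y : dom x -> dom y ->
  complex.Re (sp x y) ^+ 2 <= nq x * nq y.
Proof.
move=> dx dy; set g := complex.Re (sp x y).
have H0 (t : R) : 0 <= nq x + t ^+ 2 * nq y + 2 * (t * g).
  have dty := domZ t%:C%C dy.
  have := nq_ge0 (domD dx dty); rewrite nqD // nqZr // sip_Zr //.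
  by rewrite !ReImE oppr0 mul0r subr0.
have x0 := nq_ge0 dx; have y0 := nq_ge0 dy.
have [yp|] := ltP 0 (nq y).
  have := H0 (- g / nq y).
  have -> : nq x + (- g / nq y) ^+ 2 * nq y + 2 * (- g / nq y * g) =
      (nq x * nq y - g ^+ 2) / nq y by field; rewrite gt_eqF.
  by rewrite pmulr_lge0 ?invr_gt0 // subr_ge0.
move=> y0'; have yq0 : nq y = 0 by lra.
have {}H0 t : 0 <= nq x + 2 * (t * g) by have := H0 t; rewrite yq0; lra.
rewrite yq0 mulr0; have [->|g0] := eqVneq g 0; first by rewrite expr0n.
have := H0 (- (nq x + 1) / (2 * g)).
have -> : nq x + 2 * (- (nq x + 1) / (2 * g) * g) = -1 by field.
by rewrite ler0N1.
Qed.

Lemma cvg_Re_sip (x_ : nat -> H) x y : (forall n, dom (x_ n)) -> dom x -> dom y ->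
  nq (x_ n - x) @[n --> \oo] --> (0 : R) ->
  complex.Re (sp (x_ n) y) @[n --> \oo] --> complex.Re (sp x y).
Proof.
move=> dx_ dx dy cx.
apply/(@cvgrPdist_lt _ R^o) => e e0.
have q0 : 0 < e ^+ 2 / (nq y + 1).
  by rewrite divr_gt0 ?exprn_gt0 //; have := nq_ge0 dy; lra.
move/(@cvgrPdist_lt _ R^o) : cx => /(_ _ q0); apply: filterS => n.
have dxn := sip_domB (dx_ n) dx.
rewrite sub0r normrN ger0_norm ?nq_ge0 // => h.
have := cauchy_schwarz dxn dy; rewrite sip_Bl // !ReImE => cs.
rewrite distrC -(@ltr_pXn2r _ 2) ?nnegrE ?normr_ge0 ?(ltW e0) //.
rewrite real_normK ?num_real //; apply: le_lt_trans cs _.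
have y0 := nq_ge0 dy.
move: h; rewrite ltr_pdivlMr; last by lra.
by move=> h; apply: (le_lt_trans _ h); rewrite ler_wpM2l ?nq_ge0 // lerDl.
Qed.

Lemma cvg_Im_sip (x_ : nat -> H) x y : (forall n, dom (x_ n)) -> dom x -> dom y ->
  nq (x_ n - x) @[n --> \oo] --> (0 : R) ->
  complex.Im (sp (x_ n) y) @[n --> \oo] --> complex.Im (sp x y).
Proof.
move=> dx_ dx dy cx.
have E z : dom z -> complex.Im (sp z y) = complex.Re (sp z ('i *: y)).
  by move=> dz; rewrite sip_Zr // !ReImE; ring.
rewrite E //; under eq_fun do rewrite E //.
by apply: cvg_Re_sip => //; exact: domZ.
Qed.

(** Identities between inner products are the form in which weak curls and
    vanishing traces are stated; this is why both pass to L^2 limits. *)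
Lemma sip_eq_lim (x_ z_ : nat -> H) x z y w :
  (forall n, dom (x_ n)) -> (forall n, dom (z_ n)) ->
  dom x -> dom z -> dom y -> dom w ->
  nq (x_ n - x) @[n --> \oo] --> (0 : R) ->
  nq (z_ n - z) @[n --> \oo] --> (0 : R) ->
  (forall n, sp (x_ n) y = sp (z_ n) w) -> sp x y = sp z w.
Proof.
move=> dx_ dz_ dx dz dy dw cx cz E; apply: complex_ext.
  have := cvg_Re_sip dx_ dx dy cx; under eq_fun do rewrite E.
  by move=> /cvg_unique; apply => //; exact: cvg_Re_sip.
have := cvg_Im_sip dx_ dx dy cx; under eq_fun do rewrite E.
by move=> /cvg_unique; apply => //; exact: cvg_Im_sip.
Qed.

(** Completeness in the form in which it is used: sequences whose steps decay
    geometrically converge.  The rate 16^-n leaves room for the weights 4^n and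
    the decay 4^-n in the proof of Riesz-Fischer. *)
Definition sip_complete := forall (x_ : nat -> H) (C : R), (forall n, dom (x_ n)) ->
  (forall n, nq (x_ n.+1 - x_ n) <= C * 16 ^- n) ->
  exists2 x, dom x & nq (x_ n - x) @[n --> \oo] --> (0 : R).

End SemiInnerProduct.

(** * Projection onto the range of a closed operator bounded below *)

Section ClosedRange.
Context {R : realType} {H : lmodType R[i]}.
Variables (dom : H -> Prop) (sp : H -> H -> R[i]).
Hypothesis S : semi_inner_product dom sp.
Hypothesis complete : sip_complete dom sp.
Local Notation nq := (nq sp).

(** G U F reads: the operator maps U to F.  It is a relation because elements of
    L^2 are represented by functions, so that F determines U only up to null
    sets. *)
Record closed_bounded_below (G : H -> H -> Prop) (C : R) : Prop := {
  cbb_dom : forall U F, G U F -> dom U /\ dom F;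
  cbb_0 : G 0 0;
  cbb_lin : forall (c : R[i]) U F U' F', G U F -> G U' F' ->
    G (c *: U + U') (c *: F + F');
  cbb_bound : forall U F, G U F -> nq U <= C * nq F;
  cbb_closed : forall (U_ F_ : nat -> H) U F, (forall n, G (U_ n) (F_ n)) ->
    dom U -> dom F ->
    nq (U_ n - U) @[n --> \oo] --> (0 : R) ->
    nq (F_ n - F) @[n --> \oo] --> (0 : R) -> G U F
}.

Lemma quadratic_ge0_linear_eq0 (g q : R) :
  0 <= q -> (forall t : R, 0 <= 2 * (t * g) + t ^+ 2 * q) -> g = 0.
Proof.
move=> q0 /(_ (- g / (q + 1))).
have -> : 2 * (- g / (q + 1) * g) + (- g / (q + 1)) ^+ 2 * q =
    - (g ^+ 2 * (q + 2)) / (q + 1) ^+ 2 by field; lra.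
rewrite mulNr oppr_ge0 => h; apply/eqP; rewrite -(sqrf_eq0 g).
rewrite eq_le sqr_ge0 andbT -(@pmulr_lle0 _ (q + 2)); last by lra.
have p : 0 < ((q + 1) ^+ 2)^-1 by rewrite invr_gt0 exprn_gt0 //; lra.
by rewrite (pmulr_lle0 _ p) in h.
Qed.

(** The closest-point argument.  A minimising sequence in the range is Cauchy
    by the parallelogram identity, the lower bound makes its preimages Cauchy,
    and closedness puts the limit into the range.  At the minimum the first
    variation in every direction of the range vanishes. *)
Lemma range_projection (G : H -> H -> Prop) (C : R) : closed_bounded_below G C ->
  forall F, dom F -> exists U F0, G U F0 /\
    forall U' F', G U' F' -> sp F' (F - F0) = 0.
Proof.
move=> GC F dF.
have domB := sip_domB S.
have [gd g0 glin gb gc] := GC.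
have GB U1 F1 U2 F2 : G U1 F1 -> G U2 F2 -> G (U1 - U2) (F1 - F2).
  by move=> h1 h2; have := glin (-1) _ _ _ _ h2 h1; rewrite !scaleN1r ![- _ + _]addrC.
have GZ c U1 F1 : G U1 F1 -> G (c *: U1) (c *: F1).
  by move=> h1; have := glin c _ _ _ _ h1 g0; rewrite !addr0.
pose D := [set r : R | exists U0 F0, G U0 F0 /\ r = nq (F - F0)].
have D0 : D !=set0 by exists (nq (F - 0)); exists 0, 0.
have Dlb : has_lbound D.
  by exists 0 => r [U0 [F0 [/gd[_ dF0] ->]]]; apply: (nq_ge0 S); exact: domB.
pose d := inf D.
have dle U0 F0 : G U0 F0 -> d <= nq (F - F0).
  by move=> h; apply: ge_inf => //; exists U0, F0.
have e_gt0 n : (0 : R) < 16 ^- n by rewrite invr_gt0 exprn_gt0.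
have /choice[UF hUF] : forall n : nat, exists UF : H * H,
    G UF.1 UF.2 /\ nq (F - UF.2) < d + 16 ^- n.
  move=> n; have [r [U0 [F0 [h ->]]] rlt] := inf_adherent (e_gt0 n) (conj D0 Dlb).
  by exists (U0, F0).
pose U_ n := (UF n).1; pose F_ n := (UF n).2.
have hG n : G (U_ n) (F_ n) by case: (hUF n).
have hlt n : nq (F - F_ n) < d + 16 ^- n by case: (hUF n).
have dU_ n : dom (U_ n) by have [] := gd _ _ (hG n).
have dF_ n : dom (F_ n) by have [] := gd _ _ (hG n).
(* parallelogram identity for F - F_n and F - F_(n+1), whose mean is again
   the difference of F and an element of the range *)
have stepF n : nq (F_ n.+1 - F_ n) <= 4 * 16 ^- n.
  set a := F - F_ n; set b := F - F_ n.+1.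
  have da : dom a by exact: domB. have db : dom b by exact: domB.
  have -> : F_ n.+1 - F_ n = a - b by rewrite /a /b opprB [RHS]addrC addrA subrK.
  have mid : 4 * d <= nq (a + b).
    have := dle _ _ (GZ (2^-1)%:C%C _ _ (glin 1 _ _ _ _ (hG n) (hG n.+1))).
    have -> : F - (2^-1)%:C%C *: (1 *: F_ n + F_ n.+1) = (2^-1)%:C%C *: (a + b).
      rewrite scale1r /a /b addrACA -opprD scalerBr [_ *: (F + F)]scalerDr -scalerDl.
      congr (_ - _); rewrite (_ : _ + _ = 1) ?scale1r //.
      by apply: complex_ext; rewrite !ReImE; lra.
    by rewrite (nqZr S) => [h|]; [lra|exact: (sip_domD S)].
  have /ltW la := hlt n; have /ltW lb := hlt n.+1.
  have e1 : 16 ^- n.+1 <= 16 ^- n :> R.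
    by rewrite exprS invfM ler_piMl ?(ltW (e_gt0 n)) //; lra.
  rewrite -/a in la; rewrite -/b in lb.
  have db' : dom (- b) by exact: (sip_domN S).
  move: mid; rewrite (nqD S da db) (nqD S da db') (nqN S db) (sip_Nr S) // cRe_opp.
  lra.
have C0 : 0 <= `|C| by [].
have stepU n : nq (U_ n.+1 - U_ n) <= (`|C| * 4) * 16 ^- n.
  have h := GB _ _ _ _ (hG n.+1) (hG n).
  apply: le_trans (gb _ _ h) _; rewrite -mulrA.
  apply: (@le_trans _ _ (`|C| * nq (F_ n.+1 - F_ n))).
    by rewrite ler_wpM2r ?ler_norm ?(nq_ge0 S) //; exact: domB.
  by rewrite ler_wpM2l.
have [F0 dF0 cF] := complete dF_ stepF.
have [U0 dU0 cU] := complete dU_ stepU.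
have G0 : G U0 F0 by apply: gc hG _ _ cU cF.
exists U0, F0; split => // U' F'.
have dD : dom (F - F0) by exact: domB.
have qD : nq (F - F0) <= d.
  have c1 : nq (F - F_ n) @[n --> \oo] --> nq (F - F0).
    have E n : nq (F - F_ n) = nq (F - F0) + nq (F_ n - F0)
        - 2 * (complex.Re (sp (F_ n) (F - F0)) - complex.Re (sp F0 (F - F0))).
      have -> : F - F_ n = (F - F0) - (F_ n - F0).
        by rewrite opprB addrA subrK.
      have dn : dom (F_ n - F0) by exact: domB.
      have dn' := sip_domN S dn.
      rewrite (nqD S dD dn') (nqN S dn) (sip_Nr S dD dn) cRe_opp (Re_sip_sym S dn dD).
      by rewrite (sip_Bl S (dF_ n) dF0 dD) cRe_add cRe_opp; lra.
    have cst (r : R) : (fun _ : nat => r) @ \oo --> r by exact: cvg_cst.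
    have L := cvgB (cvgD (cst (nq (F - F0))) cF) (cvgM (cst 2)
      (cvgB (cvg_Re_sip S dF_ dF0 dD cF) (cst (complex.Re (sp F0 (F - F0)))))).
    rewrite subrr mulr0 subr0 addr0 in L.
    by under eq_fun do rewrite E; exact: L.
  have c2 : (d + 16 ^- n : R) @[n --> \oo] --> d.
    rewrite -[X in _ --> X]addr0; apply: cvgD; first exact: cvg_cst.
    under eq_fun do rewrite -exprVn.
    by apply: cvg_expr; rewrite ger0_norm ?invr_ge0 // invf_lt1 ?ltr1n.
  apply: (ler_cvg_to c1 c2); near=> n; exact: ltW.
have orth c U1 F1 : G U1 F1 -> complex.Re (sp (c *: F1) (F - F0)) = 0.
  move=> /(GZ c) h1; have [_ dF1] := gd _ _ h1.
  apply: (@quadratic_ge0_linear_eq0 _ (nq (c *: F1))); first exact: (nq_ge0 S).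
  move=> t; have h2 := glin (- t%:C%C) _ _ _ _ h1 G0.
  have := dle _ _ h2.
  have dt := sip_domZ S t%:C%C dF1.
  have -> : F - ((- t%:C%C) *: (c *: F1) + F0) = (F - F0) + t%:C%C *: (c *: F1).
    by rewrite opprD scaleNr opprK [_ *: _ - _]addrC addrA.
  rewrite (nqD S) // (nqZr S) // (Re_sip_sym S dt) // (sip_Zl S) // !ReImE.
  by lra.
move=> h; have [_ dF'] := gd _ _ h; apply: complex_ext; rewrite ?ReImE.
  by have := orth 1 _ _ h; rewrite scale1r.
have := orth 'i _ _ h; rewrite (sip_Zl S) // !ReImE; lra.
Unshelve. all: by end_near. Qed.

End ClosedRange.

(** * Completeness of the square integrable functions *)

Section GeometricCauchy.
Context {R : realType}.

(** The sequences a n - 2 K 2^-n and a n + 2 K 2^-n are monotone in opposite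
    directions and squeeze the limit, which gives convergence and the rate at
    once. *)
Lemma geometric_step_limit (a : nat -> R) (K : R) :
  (forall n, `|a n.+1 - a n| <= K * 2 ^- n) ->
  exists2 l, a n @[n --> \oo] --> l & forall n, `|a n - l| <= 2 * K * 2 ^- n.
Proof.
move=> aK.
have K0 : 0 <= K by have := aK 0%N; rewrite expr0 invr1 mulr1; apply: le_trans.
pose c n := a n - 2 * K * 2 ^- n; pose b n := a n + 2 * K * 2 ^- n.
have half n : 2 ^- n.+1 = 2 ^- n / 2 :> R by rewrite exprS invfM mulrC.
have cS n : c n <= c n.+1.
  by rewrite /c half; have := aK n; rewrite ler_norml => /andP[]; lra.
have bS n : b n.+1 <= b n.
  by rewrite /b half; have := aK n; rewrite ler_norml => /andP[]; lra.
have c_le n m : (n <= m)%N -> c n <= c m.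
  move=> /subnK <-; elim: (m - n)%N => [//|k IH]; rewrite addSn.
  exact: le_trans IH (cS _).
have b_ge n m : (n <= m)%N -> b m <= b n.
  move=> /subnK <-; elim: (m - n)%N => [//|k IH]; rewrite addSn.
  exact: le_trans (bS _) IH.
have cb n m : c n <= b m.
  apply: (@le_trans _ _ (c (maxn n m))); first exact/c_le/leq_maxl.
  apply: (@le_trans _ _ (b (maxn n m))); last exact/b_ge/leq_maxr.
  by rewrite /c /b lerD2l; rewrite ge0_cp // !mulr_ge0 // invr_ge0 exprn_ge0.
pose l := sup (range c).
have cl n : c n <= l.
  by apply: ub_le_sup; [exists (b 0%N) => _ [k _ <-]|exists n].
have lb n : l <= b n.
  by apply: ge_sup; [exists (c 0%N), 0%N|move=> _ [k _ <-]].
have al n : `|a n - l| <= 2 * K * 2 ^- n.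
  by rewrite ler_norml; have := cl n; have := lb n; rewrite /b /c; lra.
exists l => //.
have g0 : (2 * K * 2 ^- n : R) @[n --> \oo] --> (0 : R).
  rewrite -[X in _ --> X](mulr0 (2 * K)); apply: cvgM; first exact: cvg_cst.
  under eq_fun do rewrite -exprVn.
  by apply: cvg_expr; rewrite ger0_norm ?invr_ge0 // invf_lt1 ?ltr1n.
apply/(@cvgrPdist_le _ R^o) => e e0.
move/(@cvgrPdist_le _ R^o) : g0 => /(_ _ e0); apply: filterS => n.
rewrite sub0r normrN => h; rewrite distrC.
exact: le_trans (al n) (le_trans (ler_norm _) h).
Qed.

Lemma sum_geometric4 (k : nat) : \sum_(0 <= i < k) (4 ^- i : R) <= 2 - 2 * 4 ^- k.
Proof.
elim: k => [|k IH]; first by rewrite big_nil expr0 invr1; lra.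
rewrite big_nat_recr //=; apply: le_trans (lerD IH (lexx _)) _.
have p : (0 : R) < 4 ^- k by rewrite invr_gt0 exprn_gt0.
by rewrite exprS invfM; lra.
Qed.

End GeometricCauchy.

Section RieszFischer.
Context {R : realType} d (T : measurableType d) (mu : {measure set T -> \bar R}).
Variable D : set T.
Hypothesis mD : measurable D.
Implicit Types f g : T -> R.

Definition sqi f := measurable_fun D f /\
  mu.-integrable D (EFin \o (fun x => f x ^+ 2)).

Lemma sqiP f : measurable_fun D f ->
  (\int[mu]_(x in D) (f x ^+ 2)%:E < +oo)%E -> sqi f.
Proof.
move=> mf foo; split => //; apply/integrableP; split.
  by apply/measurable_EFinP; exact: measurable_funX.
under eq_integral do rewrite /= ger0_norm ?sqr_ge0 //.
exact: foo.
Qed.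

Lemma sqi_mul f g : sqi f -> sqi g -> mu.-integrable D (EFin \o (fun x => f x * g x)).
Proof.
move=> [mf intf] [mg intg].
apply: (le_integrable mD _ _ (integrableD mD intf intg)).
  by apply/measurable_EFinP; exact: measurable_funM.
move=> x _ /=; rewrite lee_fin [leRHS]ger0_norm ?addr_ge0 ?sqr_ge0 //.
by rewrite ler_norml; apply/andP; split; nra.
Qed.

Lemma sqiD f g : sqi f -> sqi g -> sqi (fun x => f x + g x).
Proof.
move=> hf hg; have [mf intf] := hf; have [mg intg] := hg.
split; first exact: measurable_funD.
have := integrableD mD (integrableD mD intf intg)
  (integrableZl mD 2 (sqi_mul hf hg)).
apply: eq_integrable => // x _ /=.
by rewrite -!EFinD; congr (_%:E); ring.
Qed.

Lemma sqiZ (c : R) f : sqi f -> sqi (fun x => c * f x).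
Proof.
move=> [mf intf]; split; first exact: measurable_funM.
have := integrableZl mD (c ^+ 2) intf; apply: eq_integrable => // x _ /=.
by rewrite -EFinM exprMn.
Qed.

Lemma sqiB f g : sqi f -> sqi g -> sqi (fun x => f x - g x).
Proof.
move=> hf /(sqiZ (-1)) hg; have := sqiD hf hg.
by under eq_fun do rewrite mulN1r.
Qed.

(** Weighting the squared steps by 4^n gives a series g with finite integral.
    Where g is finite the steps are at most sqrt g 2^-n, so the sequence
    converges there, with squared error at most 4 g 4^-n; integrating this
    bound gives convergence in mean square. *)
Lemma riesz_fischer (f_ : nat -> T -> R) (C : R) : (forall n, sqi (f_ n)) ->
  (forall n, \int[mu]_(x in D) (f_ n.+1 x - f_ n x) ^+ 2 <= C * 16 ^- n) ->
  exists2 f, sqi f &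
    \int[mu]_(x in D) (f_ n x - f x) ^+ 2 @[n --> \oo] --> (0 : R).
Proof.
move=> hf fC.
have C0 : 0 <= C.
  have := fC 0%N; rewrite expr0 invr1 mulr1; apply: le_trans.
  by apply: Rintegral_ge0 => x _; exact: sqr_ge0.
pose h n x := (f_ n.+1 x - f_ n x) ^+ 2.
have hd n := sqiB (hf n.+1) (hf n).
have mh n : measurable_fun D (h n).
  by have [m _] := hd n; exact: measurable_funX m.
have h0 n x : 0 <= h n x by exact: sqr_ge0.
have inth n : (\int[mu]_(x in D) (h n x)%:E <= (C * 16 ^- n)%:E)%E.
  rewrite -(@fineK _ (\int[mu]_(x in D) (h n x)%:E)%E).
    by rewrite lee_fin; exact: fC.
  by apply: integrable_fin_num => //; case: (hd n).
pose w n x : \bar R := (4 ^+ n * h n x)%:E.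
have w0 n x : (0 <= w n x)%E by rewrite lee_fin; apply: mulr_ge0 => //; apply: exprn_ge0; lra.
have mw n : measurable_fun D (w n).
  by apply/measurable_EFinP; exact: measurable_funM.
pose g x : \bar R := (\sum_(n <oo) w n x)%E.
have g0 x : (0 <= g x)%E by exact: nneseries_ge0.
have mg : measurable_fun D g by apply: ge0_emeasurable_sum.
have intg : (\int[mu]_(x in D) g x <= (2 * C)%:E)%E.
  rewrite integral_nneseries //.
  apply: lime_le.
    by apply: is_cvg_nneseries => n _ _; apply: integral_ge0 => x _.
  apply: nearW => k.
  apply: (@le_trans _ _ (\sum_(0 <= i < k) (C * 4 ^- i)%:E)%E).
    apply: lee_sum => n _.
    have -> : (\int[mu]_(x in D) w n x = (4 ^+ n)%:E * \int[mu]_(x in D) (h n x)%:E)%E.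
      rewrite -ge0_integralZl //.
      - exact/measurable_EFinP.
      - by move=> x _; rewrite lee_fin.
    apply: (le_trans (lee_wpmul2l _ (inth n))); first by rewrite lee_fin; apply: exprn_ge0; lra.
    rewrite -EFinM lee_fin mulrCA ler_wpM2l //.
    rewrite (_ : 16 = 4 * 4 :> R); last by ring.
    by rewrite exprMn invfM mulrA mulfV ?mul1r // expf_neq0.
  rewrite sumEFin lee_fin -mulr_sumr mulrC ler_wpM2r //.
  apply: le_trans (sum_geometric4 _) _.
  by rewrite lerBlDr lerDl mulr_ge0 // invr_ge0 exprn_ge0.
have intg' : mu.-integrable D g.
  apply/integrableP; split => //.
  under eq_integral do rewrite gee0_abs //.
  exact: le_lt_trans intg (ltry _).
pose A := D `&` [set x | (g x < +oo)%E].
have mA : measurable A by exact: emeasurable_fun_infty_o.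
have stepA n x : A x -> `|f_ n.+1 x - f_ n x| <= Num.sqrt (fine (g x)) * 2 ^- n.
  move=> [_ goo].
  have gx : (g x = (fine (g x))%:E)%E by rewrite fineK // ge0_fin_numE.
  have hg : 4 ^+ n * h n x <= fine (g x).
    rewrite -lee_fin -gx.
    apply: le_trans (nneseries_lim_ge n.+1 _) => //.
    by rewrite big_nat_recr //= leeDr // sume_ge0.
  rewrite -ler_pdivrMr ?invr_gt0 ?exprn_gt0 // invrK.
  rewrite -(@ler_pXn2r _ 2) ?nnegrE ?mulr_ge0 ?exprn_ge0 ?sqrtr_ge0 //.
  rewrite sqr_sqrtr ?fine_ge0 // exprMn real_normK ?num_real // mulrC.
  by rewrite -exprM mulnC exprM expr2 -natrM.
have mindA : measurable_fun D (\1_A : T -> R) by exact: measurable_indic.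
(* cut off to A, the sequence converges at every point, so that its limit is
   measurable *)
pose F n x := f_ n x * \1_A x.
have FA n x : A x -> F n x = f_ n x.
  by move=> Ax; rewrite /F indicE mem_set // mulr1.
have FnA n x : ~ A x -> F n x = 0.
  by move=> Ax; rewrite /F indicE memNset // mulr0.
have /choice[f hfl] : forall x, exists l, F n x @[n --> \oo] --> l /\
    (A x -> forall n, `|F n x - l| <= 2 * Num.sqrt (fine (g x)) * 2 ^- n).
  move=> x; have [Ax|nAx] := pselect (A x).
    have [|l c b] := @geometric_step_limit _ (F ^~ x) (Num.sqrt (fine (g x))).
      by move=> n; rewrite !FA //; exact: stepA.
    by exists l.
  exists 0; split => //; under eq_fun do rewrite FnA //.
  exact: cvg_cst.
have mF n : measurable_fun D (F n).
  by apply: measurable_funM => //; case: (hf n).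
have mf : measurable_fun D f.
  by apply: measurable_fun_cvg mF _ => x _; case: (hfl x).
have msq n : measurable_fun D (fun x => (f_ n x - f x) ^+ 2).
  by apply: measurable_funX; apply: measurable_funB => //; case: (hf n).
have bnd n : {ae mu, forall x, D x ->
    (((f_ n x - f x) ^+ 2)%:E <= (4 * 4 ^- n)%:E * g x)%E}.
  have := integrable_ae mD intg'; apply: filterS => x /= gfin Dx.
  have goo : (g x < +oo)%E by move: (gfin Dx); rewrite ge0_fin_numE.
  have Ax : A x by [].
  have [_ /(_ Ax n)] := hfl x; rewrite FA // => b.
  rewrite -(fineK (gfin Dx)) -EFinM lee_fin -(@real_normK _ (f_ n x - f x)) ?num_real //.
  apply: le_trans (_ : (2 * Num.sqrt (fine (g x)) * 2 ^- n) ^+ 2 <= _).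
    by rewrite ler_pXn2r // nnegrE !mulr_ge0 ?sqrtr_ge0 // invr_ge0 exprn_ge0.
  have four : (2 ^- n) ^+ 2 = 4 ^- n :> R.
    by rewrite exprVn -exprM mulnC exprM expr2 -natrM.
  rewrite !exprMn sqr_sqrtr ?fine_ge0 // four expr2.
  by rewrite -natrM -!mulrA [_ * 4 ^- n]mulrC.
have intbnd n : (\int[mu]_(x in D) ((f_ n x - f x) ^+ 2)%:E <= (8 * C * 4 ^- n)%:E)%E.
  have e0 : (0 <= (4 * 4 ^- n)%:E :> \bar R)%E.
    by rewrite lee_fin mulr_ge0 // invr_ge0 exprn_ge0.
  apply: (@le_trans _ _ (\int[mu]_(x in D) ((4 * 4 ^- n)%:E * g x))%E).
    apply: ae_ge0_le_integral => //.
    - by move=> x _; rewrite lee_fin sqr_ge0.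
    - exact/measurable_EFinP.
    - by move=> x _; apply: mule_ge0.
    - exact: measurable_funeM.
  rewrite ge0_integralZl //.
  apply: (le_trans (lee_wpmul2l e0 intg)).
  by rewrite -EFinM lee_fin mulrACA [4 * 2]mulrC [4 ^- n * C]mulrC !mulrA ler_wpM2r ?invr_ge0 ?exprn_ge0 // -!mulrA; lra.
have sqd n : sqi (fun x => f_ n x - f x).
  apply: sqiP; first by apply: measurable_funB => //; case: (hf n).
  exact: le_lt_trans (intbnd n) (ltry _).
exists f.
  have := sqiB (hf 0%N) (sqd 0%N).
  by under eq_fun do rewrite opprB addrC subrK.
have c0 : (8 * C * 4 ^- n : R) @[n --> \oo] --> (0 : R).
  rewrite -[X in _ --> X](mulr0 (8 * C)); apply: cvgM; first exact: cvg_cst.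
  under eq_fun do rewrite -exprVn.
  by apply: cvg_expr; rewrite ger0_norm ?invr_ge0 // invf_lt1 ?ltr1n.
apply: (squeeze_cvgr _ (cvg_cst 0) c0).
apply: nearW => n; apply/andP; split.
  by apply: Rintegral_ge0 => x _; exact: sqr_ge0.
rewrite -lee_fin fineK; first exact: intbnd.
by apply: integrable_fin_num => //; case: (sqd n).
Qed.

End RieszFischer.

(** * The space of square integrable complex fields *)

Section ProductSpace.
Context {R : realType} {H : lmodType R[i]}.
Variables (dom : H -> Prop) (sp : H -> H -> R[i]).
Hypothesis S : semi_inner_product dom sp.

Definition pdom (x : H * H) := dom x.1 /\ dom x.2.
(** The inner product of the direct sum. *)
Definition psp (x y : H * H) : R[i] := sp x.1 y.1 + sp x.2 y.2.

Lemma semi_inner_product_pair : semi_inner_product pdom psp.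
Proof.
split.
- by split; exact: (sip_dom0 S).
- by move=> x y [? ?] [? ?]; split; exact: (sip_domD S).
- by move=> c x [? ?]; split; exact: (sip_domZ S).
- move=> x y z [? ?] [? ?] [? ?].
  by rewrite /psp !(sip_Dl S) // addrACA.
- by move=> c x y [? ?] [? ?]; rewrite /psp !(sip_Zl S) // mulrDr.
- move=> x y [? ?] [? ?]; rewrite /psp rmorphD /=.
  by congr (_ + _); exact: (sip_conj S).
- by move=> x [? ?]; rewrite /psp cRe_add addr_ge0 //; exact: (sip_ge0 S).
Qed.

Lemma nq_pair x : nq psp x = nq sp x.1 + nq sp x.2.
Proof. exact: cRe_add. Qed.

Lemma sip_complete_pair : sip_complete dom sp -> sip_complete pdom psp.
Proof.
move=> comp x_ C dx step.
have Spos := nq_ge0 S.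
have domB := sip_domB S.
have h1 n : nq sp ((x_ n.+1).1 - (x_ n).1) <= C * 16 ^- n.
  apply: le_trans (step n); rewrite nq_pair lerDl; apply: Spos.
  by have [? ?] := dx n; have [? ?] := dx n.+1; exact: domB.
have h2 n : nq sp ((x_ n.+1).2 - (x_ n).2) <= C * 16 ^- n.
  apply: le_trans (step n); rewrite nq_pair lerDr; apply: Spos.
  by have [? ?] := dx n; have [? ?] := dx n.+1; exact: domB.
have [y1 d1 c1] := comp _ _ (fun n => (dx n).1) h1.
have [y2 d2 c2] := comp _ _ (fun n => (dx n).2) h2.
exists (y1, y2) => //; have c := cvgD c1 c2; rewrite addr0 in c.
by under eq_fun do rewrite nq_pair /=; exact: c.
Qed.

End ProductSpace.

Section L2Fields.
Context {R : realType}.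
Variable U : set (R3 R).
Hypothesis mU : measurable (U : set (E3 R)).
Notation mu := (leb3 R).
Notation fld := (R3 R -> 'cV[R[i]]_3).
Implicit Types (u v w : fld) (a b : 'cV[R[i]]_3).

Lemma sum3 (V : nmodType) (F : 'I_3 -> V) : \sum_(i < 3) F i = F 0 + F 1 + F 2.
Proof.
rewrite !big_ord_recl big_ord0 addr0 addrA.
by congr (F _ + F _ + F _); apply: val_inj.
Qed.

Lemma Re_dotC a b : complex.Re (dotC a b) = \sum_(i < 3)
  (complex.Re (a i 0) * complex.Re (b i 0) + complex.Im (a i 0) * complex.Im (b i 0)).
Proof. by rewrite /dotC !sum3 !ReImE; ring. Qed.

Lemma Im_dotC a b : complex.Im (dotC a b) = \sum_(i < 3)
  (complex.Im (a i 0) * complex.Re (b i 0) - complex.Re (a i 0) * complex.Im (b i 0)).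
Proof. by rewrite /dotC !sum3 !ReImE; ring. Qed.

Lemma sqnormE a : sqnorm a = complex.Re (dotC a a).
Proof. by rewrite Re_dotC. Qed.

Lemma sqnorm_ge0 a : 0 <= sqnorm a.
Proof. by apply: sumr_ge0 => i _; rewrite addr_ge0 ?sqr_ge0. Qed.

Definition re_part u (i : 'I_3) : E3 R -> R := fun x => complex.Re (u x i 0).
Definition im_part u (i : 'I_3) : E3 R -> R := fun x => complex.Im (u x i 0).

Lemma measurable_sqnorm u : (forall i, measurable_in U (re_part u i) /\
  measurable_in U (im_part u i)) ->
  measurable_fun U (fun x : E3 R => sqnorm (u x)).
Proof.
move=> mui; rewrite /sqnorm; under eq_fun do rewrite sum3.
by repeat apply: measurable_funD; apply: measurable_funX;
  first [exact: (mui _).1 | exact: (mui _).2].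
Qed.

Lemma L2_sqi u : L2 U u <-> forall i, sqi mu U (re_part u i) /\ sqi mu U (im_part u i).
Proof.
split=> [[mui fin] i|h].
  have mn := measurable_sqnorm mui.
  split; apply: sqiP; [exact: (mui i).1| |exact: (mui i).2|];
    apply: le_lt_trans fin; apply: ge0_le_integral => //.
  - by move=> x _; rewrite lee_fin sqr_ge0.
  - by apply/measurable_EFinP; apply: measurable_funX; exact: (mui i).1.
  - exact/measurable_EFinP.
  - move=> x _; rewrite lee_fin /sqnorm (bigD1 i) //= -addrA lerDl addr_ge0 ?sqr_ge0 //.
    by apply: sumr_ge0 => j _; rewrite addr_ge0 ?sqr_ge0.
  - by move=> x _; rewrite lee_fin sqr_ge0.
  - by apply/measurable_EFinP; apply: measurable_funX; exact: (mui i).2.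
  - exact/measurable_EFinP.
  - move=> x _; rewrite lee_fin /sqnorm (bigD1 i) //= [X in _ <= X]addrAC lerDr addr_ge0 ?sqr_ge0 //.
    by apply: sumr_ge0 => j _; rewrite addr_ge0 ?sqr_ge0.
have mui i : measurable_in U (re_part u i) /\ measurable_in U (im_part u i).
  by split; [case: (h i).1|case: (h i).2].
split => //.
have int : mu.-integrable U (fun x : E3 R => (sqnorm (u x))%:E).
  have h2 i : mu.-integrable U (EFin \o (fun x => re_part u i x ^+ 2 + im_part u i x ^+ 2)).
    by have := integrableD mU (h i).1.2 (h i).2.2.
  have := integrableD mU (integrableD mU (h2 0) (h2 1)) (h2 2).
  by apply: eq_integrable => // x _ /=; rewrite /sqnorm sum3.
have /integrableP[_] := int.
by under eq_integral do rewrite /= ger0_norm ?sqnorm_ge0 //.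
Qed.

Lemma integrable_Re_dotC u v : L2 U u -> L2 U v ->
  mu.-integrable U (EFin \o (fun x : E3 R => complex.Re (dotC (u x) (v x)))).
Proof.
move=> /L2_sqi hu /L2_sqi hv.
have h2 i : mu.-integrable U (EFin \o (fun x => re_part u i x * re_part v i x + im_part u i x * im_part v i x)).
  by have := integrableD mU (sqi_mul mU (hu i).1 (hv i).1) (sqi_mul mU (hu i).2 (hv i).2).
have := integrableD mU (integrableD mU (h2 0) (h2 1)) (h2 2).
by apply: eq_integrable => // x _ /=; rewrite Re_dotC sum3.
Qed.

Lemma L2Z (c : R[i]) u : L2 U u -> L2 U (c *: u).
Proof.
move=> /L2_sqi hu; apply/L2_sqi => i.
have [hr hi] := hu i; split.
  have := sqiB mU (sqiZ mU (complex.Re c) hr) (sqiZ mU (complex.Im c) hi).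
  by congr (sqi _ _ _); apply/funext => x; rewrite /re_part /im_part /= mxE cRe_mul.
have := sqiD mU (sqiZ mU (complex.Re c) hi) (sqiZ mU (complex.Im c) hr).
by congr (sqi _ _ _); apply/funext => x; rewrite /re_part /im_part /= mxE cIm_mul.
Qed.

Lemma L2D u v : L2 U u -> L2 U v -> L2 U (u + v).
Proof.
move=> /L2_sqi hu /L2_sqi hv; apply/L2_sqi => i; split.
  have := sqiD mU (hu i).1 (hv i).1.
  by congr (sqi _ _ _); apply/funext => x; rewrite /re_part /= mxE cRe_add.
have := sqiD mU (hu i).2 (hv i).2.
by congr (sqi _ _ _); apply/funext => x; rewrite /im_part /= mxE cIm_add.
Qed.

Lemma L20 : L2 U (0 : fld).
Proof.
apply/L2_sqi => i.
have -> : re_part 0 i = cst 0 by apply/funext => x; rewrite /re_part mxE.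
have -> : im_part 0 i = cst 0 by apply/funext => x; rewrite /im_part mxE.
suff : sqi mu U (cst 0 : E3 R -> R) by [].
apply: sqiP => //; rewrite integral0_eq // => x _.
by rewrite /cst expr0n.
Qed.

Lemma dotCZl (c : R[i]) a b : dotC (c *: a) b = c * dotC a b.
Proof. by rewrite /dotC mulr_sumr; apply: eq_bigr => i _; rewrite mxE mulrA. Qed.

Lemma dotCDl a a' b : dotC (a + a') b = dotC a b + dotC a' b.
Proof. by rewrite /dotC -big_split; apply: eq_bigr => i _; rewrite mxE mulrDl. Qed.

Lemma dotC_conj a b : dotC b a = (dotC a b)^*.
Proof. by apply: complex_ext; rewrite ?cRe_conj ?cIm_conj !(Re_dotC, Im_dotC) !sum3; ring. Qed.

Lemma integrable_Im_dotC u v : L2 U u -> L2 U v ->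
  mu.-integrable U (EFin \o (fun x : E3 R => complex.Im (dotC (u x) (v x)))).
Proof.
move=> hu hv; have := integrable_Re_dotC (L2Z (- 'i) hu) hv.
by apply: eq_integrable => // x _ /=; rewrite dotCZl !ReImE; congr (_%:E); ring.
Qed.

Lemma ip_Dl u v w : L2 U u -> L2 U v -> L2 U w -> ip U (u + v) w = ip U u w + ip U v w.
Proof.
move=> hu hv hw; apply: complex_ext; rewrite ?cRe_add ?cIm_add /=.
  rewrite -RintegralD //; [|exact: integrable_Re_dotC..].
  by apply: eq_Rintegral => x _; rewrite /= dotCDl cRe_add.
rewrite -RintegralD //; [|exact: integrable_Im_dotC..].
by apply: eq_Rintegral => x _; rewrite /= dotCDl cIm_add.
Qed.

Lemma ip_Zl (c : R[i]) u v : L2 U u -> L2 U v -> ip U (c *: u) v = c * ip U u v.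
Proof.
move=> hu hv; have ir := integrable_Re_dotC hu hv; have ii := integrable_Im_dotC hu hv.
have zr k := integrableZl mU k ir; have zi k := integrableZl mU k ii.
apply: complex_ext; rewrite ?cRe_mul ?cIm_mul /=.
  rewrite -!RintegralZl // -RintegralB //; [|exact: zr|exact: zi].
  by apply: eq_Rintegral => x _; rewrite /= dotCZl cRe_mul.
rewrite -!RintegralZl // -RintegralD //; [|exact: zi|exact: zr].
by apply: eq_Rintegral => x _; rewrite /= dotCZl cIm_mul.
Qed.

Lemma ip_conj u v : L2 U u -> L2 U v -> ip U v u = (ip U u v)^*.
Proof.
move=> hu hv; apply: complex_ext; rewrite ?cRe_conj ?cIm_conj /=.
  by apply: eq_Rintegral => x _; rewrite dotC_conj cRe_conj.
rewrite -mulN1r -RintegralZl //; last exact: integrable_Im_dotC.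
by apply: eq_Rintegral => x _; rewrite dotC_conj cIm_conj mulN1r.
Qed.

Lemma Re_ip_self u : complex.Re (ip U u u) = \int[mu]_(x in U) sqnorm (u x).
Proof. by apply: eq_Rintegral => x _; rewrite sqnormE. Qed.

Lemma semi_inner_product_L2 : semi_inner_product (L2 U : fld -> Prop) (ip U).
Proof.
split.
- exact: L20.
- exact: L2D.
- exact: L2Z.
- exact: ip_Dl.
- exact: ip_Zl.
- exact: ip_conj.
- move=> u _; rewrite Re_ip_self; apply: Rintegral_ge0 => x _; exact: sqnorm_ge0.
Qed.

End L2Fields.

Section AlmostEverywhere.
Context {R : realType}.
Variable U : set (R3 R).
Hypothesis mU : measurable (U : set (E3 R)).
Notation mu := (leb3 R).
Notation fld := (R3 R -> 'cV[R[i]]_3).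
Implicit Types (u v w : fld) (a b : 'cV[R[i]]_3).

#[local] Instance ae_leb3_filter : Filter (almost_everywhere (leb3 R)).
Proof. exact: (@ae_filter_ringOfSetsType _ _ _ mu3). Qed.
#[local] Instance nbhs_ae_leb3_filter : Filter (nbhs (almost_everywhere (leb3 R))).
Proof. exact: ae_leb3_filter. Qed.

Lemma ae_inE (P : R3 R -> Prop) :
  ae_in U P -> \forall x \ae mu, U x -> P x.
Proof. by []. Qed.

Lemma ae_inS (P Q : R3 R -> Prop) : (forall x, P x -> Q x) -> ae_in U P -> ae_in U Q.
Proof. by move=> PQ /ae_inE; apply: filterS => x Px /Px; exact: PQ. Qed.

Lemma ae_inS2 (P Q S : R3 R -> Prop) :
  (forall x, P x -> Q x -> S x) -> ae_in U P -> ae_in U Q -> ae_in U S.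
Proof.
move=> PQS /ae_inE hP /ae_inE; apply: filterS2 hP => x Px Qx Ux.
exact: PQS (Px Ux) (Qx Ux).
Qed.

Lemma ip_ae u v u' v' : L2 U u -> L2 U v -> L2 U u' -> L2 U v' ->
  ae_in U (fun x => dotC (u x) (v x) = dotC (u' x) (v' x)) ->
  ip U u v = ip U u' v'.
Proof.
move=> hu hv hu' hv' E; apply: complex_ext; congr fine; apply: ae_eq_integral => //.
- by have /integrableP[] := integrable_Re_dotC mU hu hv.
- by have /integrableP[] := integrable_Re_dotC mU hu' hv'.
- by apply: filterS (ae_inE E) => x Ex Ux; rewrite /= Ex.
- by have /integrableP[] := integrable_Im_dotC mU hu hv.
- by have /integrableP[] := integrable_Im_dotC mU hu' hv'.
- by apply: filterS (ae_inE E) => x Ex Ux; rewrite /= Ex.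
Qed.

Lemma ae_Re_ip_ge0 u v : L2 U u -> L2 U v ->
  ae_in U (fun x => 0 <= complex.Re (dotC (u x) (v x))) ->
  0 <= complex.Re (ip U u v).
Proof.
move=> hu hv pos; apply: fine_ge0.
have /integrableP[m _] := integrable_Re_dotC mU hu hv.
have -> : (\int[mu]_(x in U) (complex.Re (dotC (u x) (v x)))%:E =
    \int[mu]_(x in U) `|(complex.Re (dotC (u x) (v x)))%:E|)%E.
  apply: ae_eq_integral => //; first exact: measurableT_comp.
  by apply: filterS (ae_inE pos) => x px Ux /=; rewrite ger0_norm ?px.
by apply: integral_ge0 => x _; exact: abse_ge0.
Qed.

Lemma Re_ip_self_eq0 u : L2 U u -> complex.Re (ip U u u) = 0 ->
  ae_in U (fun x => u x = 0).
Proof.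
move=> hu; rewrite Re_ip_self => i0'.
have i0 : (\int[mu]_(x in U) (sqnorm (u x))%:E = 0)%E.
  rewrite -[LHS]fineK; first by have := congr1 (@EFin R) i0'; exact: id.
  apply: integrable_fin_num => //.
  have := integrable_Re_dotC mU hu hu; apply: eq_integrable => // x _ /=.
  by rewrite sqnormE.
have mn : measurable_fun U (fun x : E3 R => (sqnorm (u x))%:E).
  by apply/measurable_EFinP; apply: measurable_sqnorm; exact: hu.1.
have : (\int[mu]_(x in U) `|(sqnorm (u x))%:E| = 0)%E.
  rewrite -[RHS]i0; apply: eq_integral => x _.
  by rewrite /= ger0_norm ?sqnorm_ge0.
move/(ae_eq_integral_abs mu mU mn); apply: filterS => x E Ux.
have {E} [E] := E Ux.
apply/matrixP => i j; rewrite !mxE (ord1 j).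
move/eqP: E; rewrite psumr_eq0; last by move=> k _; rewrite addr_ge0 ?sqr_ge0.
move/allP/(_ i); rewrite mem_index_enum => /(_ isT) /=.
rewrite paddr_eq0 ?sqr_ge0 // !sqrf_eq0 => /andP[/eqP r /eqP m].
exact: complex_ext.
Qed.

Lemma sqi_bounded_mul (c f : E3 R -> R) (M : R) : measurable_fun U c ->
  ae_in U (fun x => `|c x| <= M) -> sqi mu U f -> sqi mu U (fun x => c x * f x).
Proof.
move=> mc cM [mf intf]; apply: sqiP; first exact: measurable_funM.
have /integrableP[_ fin] := integrableZl mU (M ^+ 2) intf.
apply: le_lt_trans fin; apply: ae_ge0_le_integral => //.
- by move=> x _; rewrite lee_fin sqr_ge0.
- by apply/measurable_EFinP; apply: measurable_funX; exact: measurable_funM.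
- apply: measurableT_comp => //; apply/measurable_EFinP.
  by apply: measurable_funM => //; exact: measurable_funX.
- apply: filterS (ae_inE cM) => x cMx Ux; rewrite -EFinM lee_fin [leRHS]ger0_norm.
    rewrite exprMn ler_wpM2r ?sqr_ge0 // -(real_normK (num_real (c x))).
    by rewrite ler_pXn2r // ?nnegrE ?normr_ge0 //; [exact: cMx|exact: le_trans (cMx Ux)].
  by rewrite mulr_ge0 ?sqr_ge0.
Qed.

Definition conj_field u : fld := fun x => map_mx (fun z : R[i] => z^*) (u x).

Lemma conj_fieldK u : conj_field (conj_field u) = u.
Proof.
apply/funext => x; apply/matrixP => i j; rewrite !mxE.
by apply: complex_ext; rewrite !ReImE ?opprK.
Qed.

Lemma L2_conj_field u : L2 U u -> L2 U (conj_field u).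
Proof.
move=> /(L2_sqi mU) h; apply/(L2_sqi mU) => i; split.
  have := (h i).1; congr (sqi _ _ _); apply/funext => x.
  by rewrite /re_part mxE cRe_conj.
have := sqiZ mU (-1) (h i).2; congr (sqi _ _ _); apply/funext => x.
by rewrite /im_part mxE cIm_conj mulN1r.
Qed.

Lemma ip_conj_field u v : L2 U u -> L2 U v -> ip U (conj_field u) (conj_field v) = (ip U u v)^*.
Proof.
move=> hu hv; rewrite -(ip_conj mU hu hv).
by apply: complex_ext; apply: eq_Rintegral => x _; congr (_ (_ : R[i]));
  apply: eq_bigr => i _; rewrite !mxE conjCK mulrC.
Qed.

(** A field is six real functions, and Riesz-Fischer applies to each. *)
Lemma sip_complete_L2 : sip_complete (L2 U : fld -> Prop) (ip U).
Proof.
move=> u_ C du step.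
have ci n i := (L2_sqi mU (u_ n)).1 (du n) i.
have sq u : L2 U u -> nq (ip U) u = \sum_(i < 3)
    (\int[mu]_(x in U) re_part u i x ^+ 2 + \int[mu]_(x in U) im_part u i x ^+ 2).
  move=> /(L2_sqi mU) hu; rewrite /nq Re_ip_self sum3.
  have hi i : mu.-integrable U (EFin \o (fun x => re_part u i x ^+ 2 + im_part u i x ^+ 2)).
    by have := integrableD mU (hu i).1.2 (hu i).2.2.
  rewrite -!RintegralD //; try solve [exact: (hu _).1.2|exact: (hu _).2.2|exact: hi].
    by apply: eq_Rintegral => x _; rewrite /sqnorm sum3.
  by have := integrableD mU (hi 0) (hi 1).
have S := semi_inner_product_L2 mU.
have pos (f : E3 R -> R) : 0 <= \int[mu]_(x in U) f x ^+ 2.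
  by apply: Rintegral_ge0 => x _; exact: sqr_ge0.
have stepr n i : \int[mu]_(x in U) (re_part (u_ n.+1) i x - re_part (u_ n) i x) ^+ 2 <= C * 16 ^- n.
  apply: le_trans (step n); rewrite sq; last exact: (sip_domB S).
  rewrite (bigD1 i) //= -addrA.
  have -> : \int[mu]_(x in U) re_part (u_ n.+1 - u_ n) i x ^+ 2 =
      \int[mu]_(x in U) (re_part (u_ n.+1) i x - re_part (u_ n) i x) ^+ 2.
    by apply: eq_Rintegral => x _; rewrite /re_part !mxE cRe_add cRe_opp.
  by rewrite lerDl addr_ge0 // sumr_ge0 // => j _; rewrite addr_ge0.
have stepi n i : \int[mu]_(x in U) (im_part (u_ n.+1) i x - im_part (u_ n) i x) ^+ 2 <= C * 16 ^- n.
  apply: le_trans (step n); rewrite sq; last exact: (sip_domB S).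
  rewrite (bigD1 i) //= addrAC.
  have -> : \int[mu]_(x in U) im_part (u_ n.+1 - u_ n) i x ^+ 2 =
      \int[mu]_(x in U) (im_part (u_ n.+1) i x - im_part (u_ n) i x) ^+ 2.
    by apply: eq_Rintegral => x _; rewrite /im_part !mxE cIm_add cIm_opp.
  by rewrite lerDr addr_ge0 // sumr_ge0 // => j _; rewrite addr_ge0.
have /choice[fr hr] : forall i : 'I_3, exists f, sqi mu U f /\
    \int[mu]_(x in U) (re_part (u_ n) i x - f x) ^+ 2 @[n --> \oo] --> (0 : R).
  move=> i; have [f h1 h2] := riesz_fischer mU (fun n => (ci n i).1) (stepr ^~ i).
  by exists f.
have /choice[fi hi] : forall i : 'I_3, exists f, sqi mu U f /\
    \int[mu]_(x in U) (im_part (u_ n) i x - f x) ^+ 2 @[n --> \oo] --> (0 : R).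
  move=> i; have [f h1 h2] := riesz_fischer mU (fun n => (ci n i).2) (stepi ^~ i).
  by exists f.
pose u : fld := fun x => \col_i Complex (fr i x) (fi i x).
have ru i : re_part u i = fr i by apply/funext => x; rewrite /re_part mxE.
have iu i : im_part u i = fi i by apply/funext => x; rewrite /im_part mxE.
have du0 : L2 U u by apply/(L2_sqi mU) => i; rewrite ru iu; split; [exact: (hr i).1|exact: (hi i).1].
exists u => //.
have E n : nq (ip U) (u_ n - u) = \sum_(i < 3)
    (\int[mu]_(x in U) (re_part (u_ n) i x - fr i x) ^+ 2 +
     \int[mu]_(x in U) (im_part (u_ n) i x - fi i x) ^+ 2).
  rewrite sq; last exact: (sip_domB S).
  apply: eq_bigr => i _; congr (_ + _); apply: eq_Rintegral => x _.
    by rewrite -ru /re_part !mxE cRe_add cRe_opp.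
  by rewrite -iu /im_part !mxE cIm_add cIm_opp.
have c3 := cvgD (cvgD (cvgD (hr 0).2 (hi 0).2) (cvgD (hr 1).2 (hi 1).2))
  (cvgD (hr 2).2 (hi 2).2).
rewrite !addr0 in c3.
by under eq_fun do rewrite E sum3; exact: c3.
Qed.

End AlmostEverywhere.

(** * Matrix coefficients *)

Section MatrixFields.
Context {R : realType}.
Variable U : set (R3 R).
Hypothesis mU : measurable (U : set (E3 R)).
Notation mu := (leb3 R).
Notation fld := (R3 R -> 'cV[R[i]]_3).
Implicit Types (u v w : fld) (a b : 'cV[R[i]]_3) (A : R3 R -> 'M[R]_3).

Lemma re_part_mul_field A u i x :
  re_part (mul_field A u) i x = A x i 0 * re_part u 0 x + A x i 1 * re_part u 1 x + A x i 2 * re_part u 2 x.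
Proof. by rewrite /re_part /mul_field !mxE sum3 !mxE !ReImE; ring. Qed.

Lemma im_part_mul_field A u i x :
  im_part (mul_field A u) i x =
  A x i 0 * im_part u 0 x + A x i 1 * im_part u 1 x + A x i 2 * im_part u 2 x.
Proof. by rewrite /im_part /mul_field !mxE sum3 !mxE !ReImE; ring. Qed.

Lemma L2_mul_field A u : Linfty_mx U A -> L2 U u -> L2 U (mul_field A u).
Proof.
move=> [mA [M AM]] /(L2_sqi mU) hu; apply/(L2_sqi mU) => i.
have h j f : sqi mu U f -> sqi mu U (fun x => A x i j * f x).
  apply: (sqi_bounded_mul mU (M := M)); first exact: mA.
  exact: ae_inS AM.
split.
  have := sqiD mU (sqiD mU (h 0 _ (hu 0).1) (h 1 _ (hu 1).1)) (h 2 _ (hu 2).1).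
  by congr (sqi _ _ _); apply/funext => x; rewrite re_part_mul_field.
have := sqiD mU (sqiD mU (h 0 _ (hu 0).2) (h 1 _ (hu 1).2)) (h 2 _ (hu 2).2).
by congr (sqi _ _ _); apply/funext => x; rewrite im_part_mul_field.
Qed.

Lemma mul_field_conj A u : mul_field A (conj_field u) = conj_field (mul_field A u).
Proof.
apply/funext => x; apply/matrixP => i j; rewrite !mxE !sum3 !mxE.
by apply: complex_ext; rewrite !ReImE; ring.
Qed.

Lemma mul_fieldD A u v : mul_field A (u + v) = mul_field A u + mul_field A v.
Proof. by apply/funext => x; rewrite /mul_field /= mulmxDr. Qed.

Lemma mul_fieldZ A (c : R[i]) u : mul_field A (c *: u) = c *: mul_field A u.
Proof. by apply/funext => x; rewrite /mul_field /= -scalemxAr. Qed.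

Lemma dotC_mulmx_sym (A : 'M[R]_3) a b : A^T = A ->
  dotC (map_mx (real_complex R) A *m a) b = dotC a (map_mx (real_complex R) A *m b).
Proof.
move=> SA; rewrite /dotC.
under eq_bigr do rewrite mxE mulr_suml.
under [RHS]eq_bigr do rewrite mxE rmorph_sum mulr_sumr.
rewrite exchange_big; apply: eq_bigr => j _; apply: eq_bigr => i _.
have real_conj (t : R) : (t%:C%C)^* = t%:C%C.
  by apply: complex_ext; rewrite !ReImE ?oppr0.
by rewrite rmorphM !mxE /= real_conj -[in RHS]SA mxE mulrA [a j 0 * _]mulrC.
Qed.

(** The entries are real, so that conjugation in the second argument does not
    affect them. *)
Lemma ip_mul_field_sym A u v : Linfty_mx U A -> symmetric_in U A ->
  L2 U u -> L2 U v -> ip U (mul_field A u) v = ip U u (mul_field A v).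
Proof.
move=> LA SA hu hv; apply: (ip_ae mU) => //; try exact: L2_mul_field.
by apply: ae_inS SA => x; exact: dotC_mulmx_sym.
Qed.

Definition quad (B : 'M[R]_3) (eta : 'cV[R]_3) : R := (eta^T *m B *m eta) 0 0.

Lemma form_bounds_scaled A lo hi : form_bounds U A lo hi ->
  ae_in U (fun x => forall eta : 'cV[R]_3,
    lo * \sum_(i < 3) eta i 0 ^+ 2 <= quad (A x) eta
      <= hi * \sum_(i < 3) eta i 0 ^+ 2).
Proof.
apply: ae_inS => x H eta; set s := \sum_(i < 3) eta i 0 ^+ 2.
have s0 : 0 <= s by apply: sumr_ge0 => i _; exact: sqr_ge0.
have [sz|sp] := eqVneq s 0.
  have e0 : eta = 0.
    apply/matrixP => i j; rewrite mxE (ord1 j); move/eqP: sz.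
    rewrite psumr_eq0; last by move=> k _; exact: sqr_ge0.
    by move/allP/(_ i); rewrite mem_index_enum sqrf_eq0 => /(_ isT)/eqP.
  by rewrite sz !mulr0 /quad e0 mulmx0 mxE lexx.
have {}s0 : 0 < s by rewrite lt_neqAle eq_sym sp.
pose t := (Num.sqrt s)^-1.
have t2 : t ^+ 2 = s^-1 by rewrite /t exprVn sqr_sqrtr ?ltW.
have := H (t *: eta).
have -> : \sum_(i < 3) (t *: eta) i 0 ^+ 2 = 1.
  under eq_bigr do rewrite mxE exprMn t2.
  by rewrite -mulr_sumr mulVf.
have -> : ((t *: eta)^T *m A x *m (t *: eta)) 0 0 = quad (A x) eta / s.
  have -> : (t *: eta)^T = t *: eta^T by apply/matrixP=> ? ?; rewrite !mxE.
  rewrite -!scalemxAl -scalemxAr scalerA -expr2 t2 mxE.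
  by rewrite mulrC.
by move=> /(_ erefl) /andP[h1 h2]; rewrite -ler_pdivlMr // h1 /= -ler_pdivrMr.
Qed.

Lemma Re_dotC_mul_field A u x :
  complex.Re (dotC (mul_field A u x) (u x)) =
  quad (A x) (\col_i re_part u i x) + quad (A x) (\col_i im_part u i x).
Proof.
transitivity (\sum_(i < 3) (re_part (mul_field A u) i x * re_part u i x +
    im_part (mul_field A u) i x * im_part u i x)); first by rewrite Re_dotC.
rewrite sum3 !re_part_mul_field !im_part_mul_field /quad !mxE !sum3 !mxE !sum3 !mxE.
ring.
Qed.

(** A real quadratic form applied to the real and imaginary parts of u. *)
Lemma form_bounds_ip A lo hi u : Linfty_mx U A -> form_bounds U A lo hi -> L2 U u ->
  lo * nq (ip U) u <= complex.Re (ip U (mul_field A u) u) <= hi * nq (ip U) u.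
Proof.
move=> LA BA hu.
have S := semi_inner_product_L2 mU.
have hA := L2_mul_field LA hu.
have sqn x : sqnorm (u x) = \sum_(i < 3) (\col_i re_part u i x) i 0 ^+ 2 +
    \sum_(i < 3) (\col_i im_part u i x) i 0 ^+ 2.
  by rewrite /sqnorm !sum3 !mxE /re_part /im_part; ring.
have B := form_bounds_scaled BA.
have Rz c : complex.Re (ip U (c%:C%C *: u) u) = c * nq (ip U) u.
  by rewrite (sip_Zl S) // !ReImE mul0r subr0.
apply/andP; split.
  have d := L2Z mU lo%:C%C hu.
  have dB := sip_domB S hA d.
  rewrite -subr_ge0 -(Rz lo) -cRe_opp -cRe_add -(sip_Bl S hA d hu).
  apply: (ae_Re_ip_ge0 mU dB hu).
  apply: ae_inS B => x B; rewrite /= dotCDl cRe_add Re_dotC_mul_field.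
  rewrite -scaleNr dotCZl !ReImE oppr0 mul0r subr0 -sqnormE sqn.
  have /andP[b1 _] := B (\col_i re_part u i x).
  have /andP[b2 _] := B (\col_i im_part u i x).
  by rewrite mulNr subr_ge0 mulrDr lerD.
have d := L2Z mU hi%:C%C hu.
have dB := sip_domB S d hA.
rewrite -subr_ge0 -(Rz hi) -cRe_opp -cRe_add -(sip_Bl S d hA hu).
apply: (ae_Re_ip_ge0 mU dB hu).
apply: ae_inS B => x B; rewrite /= dotCDl cRe_add.
rewrite -scaleN1r !dotCZl mulN1r cRe_opp Re_dotC_mul_field !ReImE mul0r subr0 -sqnormE sqn.
have /andP[_ b1] := B (\col_i re_part u i x).
have /andP[_ b2] := B (\col_i im_part u i x).
by rewrite subr_ge0 mulrDr lerD.
Qed.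

End MatrixFields.

(** * The curl operators *)

Section CurlOperators.
Context {R : realType}.
Variable U : set (R3 R).
Hypothesis oU : open U.
Let mU : measurable (U : set (E3 R)) := open_measurable3 oU.
Notation mu := (leb3 R).
Notation fld := (R3 R -> 'cV[R[i]]_3).
Implicit Types (u v w z : fld) (phi psi : R3 R -> 'cV[R]_3).
Let S := semi_inner_product_L2 mU.

Lemma sqi_compact_support (K : set (R3 R)) (f : R3 R -> R) : compact K ->
  continuous f -> (forall x, ~ K x -> f x = 0) -> sqi mu U f.
Proof.
move=> cK cf f0; split.
  by apply: measurable_funTS; exact: continuous_measurable3.
have : mu3.-integrable U (EFin \o (fun x : E3 R => f x ^+ 2)).
  apply: (@integrableS _ _ _ _ setT) => //.
  apply: (@compact_support_integrable _ K (fun x => f x ^+ 2)) => //.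
    by move=> x; apply: cvgM; exact: cf.
  by move=> x /f0 ->; rewrite expr0n.
by [].
Qed.

Lemma L2_complexify phi : (forall i, sqi mu U (fun x => phi x i 0)) ->
  L2 U (complexify phi).
Proof.
move=> h; apply/(L2_sqi mU) => i; split.
  have := h i; congr (sqi _ _ _); apply/funext => x.
  by rewrite /re_part /complexify mxE.
have := sqiZ mU 0 (h i); congr (sqi _ _ _); apply/funext => x.
by rewrite /im_part /complexify mxE mul0r.
Qed.

Lemma ip_complexify phi psi : ip U (complexify phi) (complexify psi) =
  (\int[mu]_(x in U) \sum_(i < 3) phi x i 0 * psi x i 0)%:C%C.
Proof.
apply: complex_ext; rewrite ?cRe_real ?cIm_real /=.
  apply: eq_Rintegral => x _; rewrite Re_dotC; apply: eq_bigr => i _.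
  by rewrite /complexify !mxE !ReImE mul0r addr0.
rewrite -[RHS](@Rintegral_set0 _ _ _ mu (cst 0)) /Rintegral integral_set0.
rewrite integral0_eq // => x _; congr (_%:E).
rewrite Im_dotC big1 // => i _.
by rewrite /complexify !mxE !ReImE mul0r mulr0 subr0.
Qed.

Definition support phi := closure [set x | phi x != 0].

Lemma test_fieldP phi : test_field U phi ->
  [/\ compact (support phi), support phi `<=` U &
  forall i, [/\ continuous (fun x => phi x i 0),
    (forall j x, derivable (fun x => phi x i 0) x (axis j)),
    (forall j, continuous (partial j (fun x => phi x i 0))) &
    forall x, ~ support phi x -> phi x i 0 = 0]].
Proof.
move=> [sm cK KU]; split => // i; have [c0 d0] := sm i [::]; split => //.
- by move=> j; have [] := sm i [:: j].
- move=> x nKx; have [->|pn] := eqVneq (phi x) 0; first by rewrite mxE.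
  by exfalso; apply: nKx; apply: subset_closure.
Qed.

Lemma classical_curl_coords phi x :
  [/\ classical_curl phi x 0 0 =
      partial 1 (fun y => phi y 2 0) x - partial 2 (fun y => phi y 1 0) x,
    classical_curl phi x 1 0 =
      partial 2 (fun y => phi y 0 0) x - partial 0 (fun y => phi y 2 0) x &
    classical_curl phi x 2 0 =
      partial 0 (fun y => phi y 1 0) x - partial 1 (fun y => phi y 0 0) x].
Proof.
have e1 : (1 + 1 : 'I_3) = 2 by apply: val_inj.
have e2 : (1 + 2 : 'I_3) = 0 by apply: val_inj.
have e3 : (2 + 1 : 'I_3) = 0 by apply: val_inj.
have e4 : (2 + 2 : 'I_3) = 1 by apply: val_inj.
by rewrite /classical_curl !mxE !add0r e1 e2 e3 e4.
Qed.

Lemma sqi_test phi i : test_field U phi -> sqi mu U (fun x => phi x i 0).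
Proof.
move=> /test_fieldP[cK _ /(_ i)[c0 _ _ s0]].
exact: sqi_compact_support cK c0 s0.
Qed.

Lemma sqi_partial_test phi i j : test_field U phi ->
  sqi mu U (partial j (fun x => phi x i 0)).
Proof.
move=> /test_fieldP[cK _ /(_ i)[c0 _ c1 s0]].
exact: sqi_compact_support cK (c1 j) (partial_support j cK s0).
Qed.

Lemma L2_test phi : test_field U phi -> L2 U (complexify phi).
Proof. by move=> t; apply: L2_complexify => i; exact: sqi_test. Qed.

Lemma L2_curl_test phi : test_field U phi -> L2 U (complexify (classical_curl phi)).
Proof.
move=> t; apply: L2_complexify => i.
under eq_fun do rewrite mxE.
by apply: (sqiB mU); exact: sqi_partial_test.
Qed.

(** The bookkeeping of the six terms of the integral of curl phi . psi: moving
    the derivative of each one to psi permutes them, up to sign, into those of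
    phi . curl psi. *)
Lemma by_parts_sum (P Q : 'I_3 -> 'I_3 -> 'I_3 -> R) :
  (forall j a b, P j a b = - Q j a b) ->
  P 1 2 0 - P 2 1 0 + (P 2 0 1 - P 0 2 1) + (P 0 1 2 - P 1 0 2) =
  Q 1 0 2 - Q 2 0 1 + (Q 2 1 0 - Q 0 1 2) + (Q 0 2 1 - Q 1 2 0).
Proof. by move=> PQ; rewrite !PQ; ring. Qed.

Lemma Rintegral_three_differences (f g f' g' f'' g'' : E3 R -> R) :
  mu.-integrable U (EFin \o f) -> mu.-integrable U (EFin \o g) ->
  mu.-integrable U (EFin \o f') -> mu.-integrable U (EFin \o g') ->
  mu.-integrable U (EFin \o f'') -> mu.-integrable U (EFin \o g'') ->
  \int[mu]_(x in U) f x - \int[mu]_(x in U) g x +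
    (\int[mu]_(x in U) f' x - \int[mu]_(x in U) g' x) +
    (\int[mu]_(x in U) f'' x - \int[mu]_(x in U) g'' x) =
  \int[mu]_(x in U) (f x - g x + (f' x - g' x) + (f'' x - g'' x)).
Proof.
move=> hf hg hf' hg' hf'' hg''.
have i1 := integrableB mU hf hg; have i2 := integrableB mU hf' hg'.
have i3 := integrableB mU hf'' hg''; have i4 := integrableD mU i1 i2.
by rewrite -!RintegralB // -!RintegralD.
Qed.

(** The pointwise curl of a test field is its weak curl: both sides are sums of
    six integrals, matched by integration by parts. *)
Lemma is_curl_test phi : test_field U phi ->
  is_curl U (complexify phi) (complexify (classical_curl phi)).
Proof.
move=> tphi; split; [exact: L2_test|exact: L2_curl_test|move=> psi tpsi].
rewrite !ip_complexify; congr (_%:C%C).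
have [cK KU hphi] := test_fieldP tphi; have [cL LU hpsi] := test_fieldP tpsi.
pose P j a b := \int[mu]_(x in U) (partial j (fun y => phi y a 0) x * psi x b 0).
pose Q j a b := \int[mu]_(x in U) (phi x a 0 * partial j (fun y => psi y b 0) x).
have PQ j a b : P j a b = - Q j a b.
  have [ca da pa sa] := hphi a; have [cb db pb sb] := hpsi b.
  have cKL : compact (support phi `|` support psi) by exact: compactU.
  have KLU : support phi `|` support psi `<=` U by move=> x [/KU|/LU].
  apply: (integration_by_parts3 mU cKL KLU) => //.
    by move=> x nKL; apply: sa => h; apply: nKL; left.
  by move=> x nKL; apply: sb => h; apply: nKL; right.
have iP j a b : mu.-integrable U (EFin \o
    (fun x : E3 R => partial j (fun y => phi y a 0) x * psi x b 0)).
  by apply: (sqi_mul mU); [exact: sqi_partial_test|exact: sqi_test].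
have iQ j a b : mu.-integrable U (EFin \o
    (fun x : E3 R => phi x a 0 * partial j (fun y => psi y b 0) x)).
  by apply: (sqi_mul mU); [exact: sqi_test|exact: sqi_partial_test].
transitivity (P 1 2 0 - P 2 1 0 + (P 2 0 1 - P 0 2 1) + (P 0 1 2 - P 1 0 2)).
  rewrite /P Rintegral_three_differences //; apply: eq_Rintegral => x _.
  have [c0 c1 c2] := classical_curl_coords phi x.
  by rewrite sum3 c0 c1 c2 !mulrBl.
rewrite (by_parts_sum PQ) /Q; clear iP PQ P.
rewrite Rintegral_three_differences //; apply: eq_Rintegral => x _.
have [c0 c1 c2] := classical_curl_coords psi x.
by rewrite sum3 c0 c1 c2 !mulrBr.
Qed.

(** curl_0 is the full Hilbert space adjoint of curl.  Membership in H(curl)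
    comes for free, because test fields are in H(curl). *)
Lemma is_curl0_of_adjoint u w : L2 U u -> L2 U w ->
  (forall v z, is_curl U v z -> ip U w v = ip U u z) -> is_curl0 U u w.
Proof.
move=> hu hw adj; split.
  by split => // phi /is_curl_test; exact: adj.
by move=> v z vz; rewrite (adj _ _ vz) subrr.
Qed.

Lemma is_curl0_adjoint u w v z : is_curl0 U u w -> is_curl U v z ->
  ip U w v = ip U u z.
Proof. by move=> [_ t] vz; apply/eqP; rewrite -subr_eq0; apply/eqP; exact: t. Qed.

(** The defining identity of a weak curl, read from the other side. *)
Lemma is_curl0_test phi : test_field U phi ->
  is_curl0 U (complexify phi) (complexify (classical_curl phi)).
Proof.
move=> t; have h1 := L2_test t; have h2 := L2_curl_test t.
apply: is_curl0_of_adjoint => // v z [hv hz /(_ _ t) E].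
by rewrite (ip_conj mU hv h2) -E -(ip_conj mU hz h1).
Qed.

Lemma is_curl_lin (c : R[i]) u w u' w' : is_curl U u w -> is_curl U u' w' ->
  is_curl U (c *: u + u') (c *: w + w').
Proof.
move=> [hu hw E] [hu' hw' E'].
have [zu zw] := (sip_domZ S c hu, sip_domZ S c hw).
split; [exact: (sip_domD S)|exact: (sip_domD S)|move=> phi t].
have h1 := L2_test t; have h2 := L2_curl_test t.
rewrite (sip_Dl S zw hw' h1) (sip_Dl S zu hu' h2) (sip_Zl S c hw h1) (sip_Zl S c hu h2).
by rewrite (E _ t) (E' _ t).
Qed.

Lemma is_curl0_lin (c : R[i]) u w u' w' : is_curl0 U u w -> is_curl0 U u' w' ->
  is_curl0 U (c *: u + u') (c *: w + w').
Proof.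
move=> uw uw'; have [h _] := uw; have [h' _] := uw'.
split; first exact: is_curl_lin.
move=> v z vz; have [hv hz _] := vz.
have [hu hw _] := h; have [hu' hw' _] := h'.
have [zu zw] := (sip_domZ S c hu, sip_domZ S c hw).
rewrite (sip_Dl S zw hw' hv) (sip_Dl S zu hu' hz) (sip_Zl S c hw hv) (sip_Zl S c hu hz).
by rewrite (is_curl0_adjoint uw vz) (is_curl0_adjoint uw' vz) subrr.
Qed.

Lemma ip_0l v : L2 U v -> ip U 0 v = 0.
Proof.
move=> hv; rewrite -[0 : fld](scale0r (0 : fld)).
by rewrite (sip_Zl S 0 (sip_dom0 S) hv) mul0r.
Qed.

Lemma is_curl_00 : is_curl U 0 0.
Proof.
have h0 := sip_dom0 S; split => [||phi t]; [exact: h0|exact: h0|].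
by rewrite (ip_0l (L2_test t)) (ip_0l (L2_curl_test t)).
Qed.

Lemma is_curl0_00 : is_curl0 U 0 0.
Proof.
split; first exact: is_curl_00.
by move=> v z [hv hz _]; rewrite (ip_0l hv) (ip_0l hz) subrr.
Qed.

Lemma ip_ae_l w w' v : L2 U w -> L2 U w' -> L2 U v ->
  ae_in U (fun x => w x = w' x) -> ip U w v = ip U w' v.
Proof. by move=> hw hw' hv E; apply: (ip_ae mU) => //; apply: ae_inS E => x ->. Qed.

Lemma is_curl_ae u w w' : L2 U w' -> ae_in U (fun x => w x = w' x) ->
  is_curl U u w -> is_curl U u w'.
Proof.
move=> hw' E [hu hw C]; split => // phi t.
by rewrite -C // (ip_ae_l hw hw' _ E) //; exact: L2_test.
Qed.

Lemma is_curl0_ae u w w' : L2 U w' -> ae_in U (fun x => w x = w' x) ->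
  is_curl0 U u w -> is_curl0 U u w'.
Proof.
move=> hw' E uw; have [h _] := uw; split; first exact: is_curl_ae E h.
have [_ hw _] := h.
move=> v z vz; have [hv _ _] := vz.
by rewrite -(ip_ae_l hw hw' hv E) (is_curl0_adjoint uw vz) subrr.
Qed.

Lemma complexify_conj phi : conj_field (complexify phi) = complexify phi.
Proof.
apply/funext => x; apply/matrixP => i j; rewrite !mxE.
by apply: complex_ext; rewrite !ReImE ?oppr0.
Qed.

(** Test fields are real. *)
Lemma is_curl_conj u w : is_curl U u w -> is_curl U (conj_field u) (conj_field w).
Proof.
move=> [hu hw E]; split; [exact: L2_conj_field|exact: L2_conj_field|move=> phi t].
have h1 := L2_test t; have h2 := L2_curl_test t.
rewrite -[complexify phi]complexify_conj -[complexify (classical_curl phi)]complexify_conj.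
by rewrite (ip_conj_field mU hw h1) (ip_conj_field mU hu h2) (E _ t).
Qed.

Lemma is_curl_lim (u_ w_ : nat -> fld) u w : (forall n, is_curl U (u_ n) (w_ n)) ->
  L2 U u -> L2 U w ->
  nq (ip U) (u_ n - u) @[n --> \oo] --> (0 : R) ->
  nq (ip U) (w_ n - w) @[n --> \oo] --> (0 : R) -> is_curl U u w.
Proof.
move=> C hu hw cu cw; split => // phi t.
have h1 := L2_test t; have h2 := L2_curl_test t.
have du n : L2 U (u_ n) by have [] := C n.
have dw n : L2 U (w_ n) by have [] := C n.
have E n : ip U (w_ n) (complexify phi) = ip U (u_ n) (complexify (classical_curl phi)).
  by have [_ _ h] := C n; exact: h.
exact: (sip_eq_lim S dw du hw hu h1 h2 cw cu E).
Qed.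

Lemma is_curl0_lim (u_ w_ : nat -> fld) u w : (forall n, is_curl0 U (u_ n) (w_ n)) ->
  L2 U u -> L2 U w ->
  nq (ip U) (u_ n - u) @[n --> \oo] --> (0 : R) ->
  nq (ip U) (w_ n - w) @[n --> \oo] --> (0 : R) -> is_curl0 U u w.
Proof.
move=> C hu hw cu cw; apply: is_curl0_of_adjoint => // v z vz.
have [hv hz _] := vz.
have du n : L2 U (u_ n) by have [[]] := C n.
have dw n : L2 U (w_ n) by have [[]] := C n.
have E n : ip U (w_ n) v = ip U (u_ n) z by exact: is_curl0_adjoint (C n) vz.
exact: (sip_eq_lim S dw du hw hu hv hz cw cu E).
Qed.

End CurlOperators.

(** * Convergence in mean square *)

Section Convergence.
Context {R : realType} {H : lmodType R[i]}.
Variables (dom : H -> Prop) (sp : H -> H -> R[i]).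
Hypothesis S : semi_inner_product dom sp.
Local Notation nq := (nq sp).

Lemma nq_cvgD (x_ y_ : nat -> H) x y : (forall n, dom (x_ n)) ->
  (forall n, dom (y_ n)) -> dom x -> dom y ->
  nq (x_ n - x) @[n --> \oo] --> (0 : R) ->
  nq (y_ n - y) @[n --> \oo] --> (0 : R) ->
  nq (x_ n + y_ n - (x + y)) @[n --> \oo] --> (0 : R).
Proof.
move=> dx_ dy_ dx dy cx cy.
have c : 2 * (nq (x_ n - x) + nq (y_ n - y)) @[n --> \oo] --> (0 : R).
  by have c := cvgM (cvg_cst (2 : R)) (cvgD cx cy); rewrite addr0 mulr0 in c; exact: c.
apply: (squeeze_cvgr _ (cvg_cst (0 : R)) c); apply: nearW => n.
have dX := sip_domB S (dx_ n) dx; have dY := sip_domB S (dy_ n) dy.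
have -> : x_ n + y_ n - (x + y) = (x_ n - x) + (y_ n - y) by rewrite opprD addrACA.
have h := nq_sum_le S dX dY.
apply/andP; split; last exact: h.
exact: (nq_ge0 S (sip_domD S dX dY)).
Qed.

Lemma nq_cvgZ (c : R[i]) (x_ : nat -> H) x : (forall n, dom (x_ n)) -> dom x ->
  nq (x_ n - x) @[n --> \oo] --> (0 : R) ->
  nq (c *: x_ n - c *: x) @[n --> \oo] --> (0 : R).
Proof.
move=> dx_ dx cx.
have k := cvgM (cvg_cst (complex.Re c ^+ 2 + complex.Im c ^+ 2)) cx.
rewrite mulr0 in k.
have E n : nq (c *: x_ n - c *: x) =
    (complex.Re c ^+ 2 + complex.Im c ^+ 2) * nq (x_ n - x).
  by rewrite -scalerBr (nqZ S c (sip_domB S (dx_ n) dx)).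
by under eq_fun do rewrite E; exact: k.
Qed.

End Convergence.

Section BoundedMultiplication.
Context {R : realType}.
Variable U : set (R3 R).
Hypothesis mU : measurable (U : set (E3 R)).
Notation mu := (leb3 R).
Notation fld := (R3 R -> 'cV[R[i]]_3).
Let S := semi_inner_product_L2 mU.

Lemma sqr_row_le (M a b c x y z : R) : `|a| <= M -> `|b| <= M -> `|c| <= M ->
  (a * x + b * y + c * z) ^+ 2 <= 3 * M ^+ 2 * (x ^+ 2 + y ^+ 2 + z ^+ 2).
Proof.
move=> aM bM cM.
have sq (t s : R) : `|t| <= M -> (t * s) ^+ 2 <= M ^+ 2 * s ^+ 2.
  move=> tM; rewrite exprMn ler_wpM2r ?sqr_ge0 // -(real_normK (num_real t)).
  by rewrite ler_pXn2r // ?nnegrE ?normr_ge0 // (le_trans _ tM).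
have h1 := sq _ x aM; have h2 := sq _ y bM; have h3 := sq _ z cM.
move: h1 h2 h3; set p := a * x; set q := b * y; set r := c * z => h1 h2 h3.
apply: (@le_trans _ _ (3 * (p ^+ 2 + q ^+ 2 + r ^+ 2))); last by lra.
have := sqr_ge0 (p - q); have := sqr_ge0 (q - r); have := sqr_ge0 (p - r).
by rewrite !expr2; lra.
Qed.

(** If the entries are at most M in absolute value, each row contributes at most
    3 M^2 times the squared norm, and there are three rows. *)
Lemma nq_mul_field_le (A : R3 R -> 'M[R]_3) : Linfty_mx U A ->
  exists2 C : R, 0 <= C & forall u, L2 U u -> nq (ip U) (mul_field A u) <= C * nq (ip U) u.
Proof.
move=> LA; have [mA [M AM]] := LA.
have C0 : 0 <= 9 * M ^+ 2 by rewrite mulr_ge0 ?sqr_ge0.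
exists (9 * M ^+ 2) => // u hu.
have hAu := L2_mul_field mU LA hu.
have iu : mu.-integrable U (EFin \o (fun x : E3 R => sqnorm (u x))).
  have := integrable_Re_dotC mU hu hu; apply: eq_integrable => // x _ /=.
  by rewrite sqnormE.
have iAu : mu.-integrable U (EFin \o (fun x : E3 R => sqnorm (mul_field A u x))).
  have := integrable_Re_dotC mU hAu hAu; apply: eq_integrable => // x _ /=.
  by rewrite sqnormE.
have iC := integrableZl mU (9 * M ^+ 2) iu.
rewrite /nq !Re_ip_self -RintegralZl //.
rewrite -lee_fin /Rintegral !fineK; try exact: integrable_fin_num.
apply: ae_ge0_le_integral => //.
- by move=> x _; rewrite lee_fin sqnorm_ge0.
- by have /integrableP[] := iAu.
- by move=> x _; rewrite lee_fin mulr_ge0 ?sqnorm_ge0.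
- by have /integrableP[] := iC.
suff : ae_in U (fun x => ((sqnorm (mul_field A u x))%:E <=
    (9 * M ^+ 2 * sqnorm (u x))%:E)%E) by [].
apply: ae_inS AM => x Ax; rewrite lee_fin.
have row (f : 'I_3 -> R) (i : 'I_3) := @sqr_row_le M (A x i 0) (A x i 1) (A x i 2) (f 0) (f 1) (f 2)
   (Ax i 0) (Ax i 1) (Ax i 2).
have sq (v : fld) : sqnorm (v x) = (re_part v 0 x ^+ 2 + im_part v 0 x ^+ 2)
  + (re_part v 1 x ^+ 2 + im_part v 1 x ^+ 2) + (re_part v 2 x ^+ 2 + im_part v 2 x ^+ 2).
  by rewrite /sqnorm sum3.
rewrite (sq (mul_field A u)) (sq u) !re_part_mul_field !im_part_mul_field.
have r0 := row (fun j => re_part u j x) 0; have r1 := row (fun j => re_part u j x) 1.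
have r2 := row (fun j => re_part u j x) 2.
have i0 := row (fun j => im_part u j x) 0; have i1 := row (fun j => im_part u j x) 1.
have i2 := row (fun j => im_part u j x) 2.
have := lerD (lerD (lerD r0 i0) (lerD r1 i1)) (lerD r2 i2).
move=> h; apply: (le_trans h).
by rewrite le_eqVlt; apply/orP; left; apply/eqP; ring.
Qed.

Lemma cvg_mul_field (A : R3 R -> 'M[R]_3) (x_ : nat -> fld) (x : fld) :
  Linfty_mx U A -> (forall n, L2 U (x_ n)) -> L2 U x ->
  nq (ip U) (x_ n - x) @[n --> \oo] --> (0 : R) ->
  nq (ip U) (mul_field A (x_ n) - mul_field A x) @[n --> \oo] --> (0 : R).
Proof.
move=> LA dx_ dx cx; have [C C0 hC] := nq_mul_field_le LA.
have c : C * nq (ip U) (x_ n - x) @[n --> \oo] --> (0 : R).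
  by have c := cvgM (cvg_cst C) cx; rewrite mulr0 in c; exact: c.
apply: (squeeze_cvgr _ (cvg_cst (0 : R)) c); apply: nearW => n.
have dX := sip_domB S (dx_ n) dx.
have -> : mul_field A (x_ n) - mul_field A x = mul_field A (x_ n - x).
  by rewrite mul_fieldD -scaleN1r -mul_fieldZ scaleN1r.
apply/andP; split; last exact: hC.
exact: (nq_ge0 S (L2_mul_field mU LA dX)).
Qed.

End BoundedMultiplication.

(** * The Maxwell pencil *)

(** Linearity of [curl_electric] in the state and the data, at one point. *)
Lemma scale_lin1 (K : comPzRingType) n (I o c : K) (m m' f f' : 'cV[K]_n) :
  I *: (c *: f + f' + o *: (c *: m + m')) =
  c *: (I *: (f + o *: m)) + I *: (f' + o *: m').
Proof. by apply/matrixP => i j; rewrite !mxE; ring. Qed.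

(** Linearity of [curl_magnetic] in the state and the data, at one point. *)
Lemma scale_lin2 (K : comPzRingType) n (I J o c : K) (m m' e e' f f' : 'cV[K]_n) :
  I *: (c *: f + f' + (J *: (c *: m + m') + o *: (c *: e + e'))) =
  c *: (I *: (f + (J *: m + o *: e))) + I *: (f' + (J *: m' + o *: e')).
Proof. by apply/matrixP => i j; rewrite !mxE; ring. Qed.

Lemma energy_algebra (R : rcfType) (o z w es ee em e1 e2 : R[i]) :
  e1 = 'i * z + (- 'i * es + - o * ee) -> e2 = - 'i * w + - o * em -> w = z^* ->
  complex.Im es = 0 -> complex.Im ee = 0 -> complex.Im em = 0 ->
  complex.Im e1 + complex.Im e2 =
    - complex.Re es - complex.Im o * (complex.Re ee + complex.Re em) /\
  complex.Re e1 - complex.Re e2 = - complex.Re o * (complex.Re ee - complex.Re em).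
Proof.
move=> -> -> -> s0 u0 v0; rewrite !ReImE s0 u0 v0.
by split; ring.
Qed.

Lemma Re_twisted_sum (R : rcfType) (t : R) (p q : R[i]) :
  complex.Re ((Complex (- t) 1)^* * p + (Complex t 1)^* * q) =
  complex.Im p + complex.Im q - t * (complex.Re p - complex.Re q).
Proof.
rewrite cRe_add !cRe_mul !cRe_conj !cIm_conj.
rewrite [complex.Re (Complex (- t) 1)]/= [complex.Im (Complex (- t) 1)]/=.
rewrite [complex.Re (Complex t 1)]/= [complex.Im (Complex t 1)]/=.
ring.
Qed.

Lemma complement_algebra1 (R : rcfType) (o a b : R[i]) : 'i * a + - o * b = 0 ->
  a = - ('i * (o * b)).
Proof.
move=> h; have -> : 'i * (o * b) = 'i * ('i * a).
  by congr (_ * _); apply/eqP; rewrite eq_sym -subr_eq0 -mulNr h.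
by rewrite mulrA i_sqr mulN1r opprK.
Qed.

Lemma complement_algebra2 (R : rcfType) (o s e w : R[i]) :
  - 'i * s + - o * e + - 'i * w = 0 -> - 'i * ('i * s + o * e) = - w.
Proof.
move=> h.
have -> : 'i * s + o * e = - ('i * w).
  apply/eqP; rewrite -subr_eq0 opprK -oppr_eq0 -h; apply/eqP; ring.
by rewrite mulrNN mulrA i_sqr mulN1r.
Qed.

Lemma square_bound (R : realFieldType) (k t X F r : R) : 0 < k -> 0 <= X -> 0 <= F ->
  k * X <= r -> r ^+ 2 <= (1 + t ^+ 2) * F * X -> X <= (1 + t ^+ 2) / k ^+ 2 * F.
Proof.
move=> k0 X0 F0 kX rF.
have [->|Xn] := eqVneq X 0.
  by rewrite !mulr_ge0 ?invr_ge0 ?exprn_ge0 ?(ltW k0) // addr_ge0 ?sqr_ge0.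
have Xp : 0 < X by rewrite lt_neqAle eq_sym Xn.
have h : (k * X) ^+ 2 <= (1 + t ^+ 2) * F * X.
  apply: le_trans rF; rewrite ler_pXn2r ?nnegrE //; first by rewrite mulr_ge0 // ltW.
  by apply: le_trans kX; rewrite mulr_ge0 // ltW.
rewrite mulrAC ler_pdivlMr ?exprn_gt0 //.
rewrite -(ler_pM2r Xp); apply: le_trans h.
by rewrite le_eqVlt (_ : X * k ^+ 2 * X = (k * X) ^+ 2) ?eqxx //; ring.
Qed.

Section MaxwellPencil.
Context {R : realType}.
Variable U : set (R3 R).
Hypothesis oU : open U.
Let mU : measurable (U : set (E3 R)) := open_measurable3 oU.
Notation fld := (R3 R -> 'cV[R[i]]_3).
Notation state' := (fld * fld)%type.
Variables eps mu sigma : R3 R -> 'M[R]_3.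
Hypothesis Leps : Linfty_mx U eps.
Hypothesis Lmu : Linfty_mx U mu.
Hypothesis Lsigma : Linfty_mx U sigma.
Hypothesis Seps : symmetric_in U eps.
Hypothesis Smu : symmetric_in U mu.
Hypothesis Ssigma : symmetric_in U sigma.
Variable omega : R[i].
Local Notation V := (maxwell U eps mu sigma omega).
Let S := semi_inner_product_L2 mU.
Let S2 := semi_inner_product_pair S.
Local Notation dom2 := (pdom (L2 U : fld -> Prop)).
Local Notation sp2 := (psp (ip U)).
Local Notation nq1 := (nq (ip U)).
Local Notation nq2 := (nq sp2).

(** The value of curl_0 u forced by the second row of the equations. *)
Definition curl_electric (X F : state') : fld :=
  'i *: (F.2 + omega *: mul_field mu X.2).
(** The value of curl v forced by the first row of the equations. *)
Definition curl_magnetic (X F : state') : fld :=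
  - 'i *: (F.1 + ('i *: mul_field sigma X.1 + omega *: mul_field eps X.1)).

Lemma L2_curl_electric X F : L2 U X.2 -> L2 U F.2 -> L2 U (curl_electric X F).
Proof.
move=> hX hF; apply: (sip_domZ S); apply: (sip_domD S hF); apply: (sip_domZ S).
exact: (L2_mul_field mU).
Qed.

Lemma L2_curl_magnetic X F : L2 U X.1 -> L2 U F.1 -> L2 U (curl_magnetic X F).
Proof.
move=> hX hF; apply: (sip_domZ S); apply: (sip_domD S hF).
by apply: (sip_domD S); apply: (sip_domZ S); exact: (L2_mul_field mU).
Qed.

Lemma curl_electricE X F x : curl_electric X F x =
  'i *: (F.2 x + omega *: mul_field mu X.2 x).
Proof. by []. Qed.

Lemma curl_magneticE X F x : curl_magnetic X F x =
  - 'i *: (F.1 x + ('i *: mul_field sigma X.1 x + omega *: mul_field eps X.1 x)).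
Proof. by []. Qed.

(** The equations determine the two curls from the state and the data; with
    these representatives, the graph of the pencil involves the curls only
    through the closed relations of being a curl. *)
Lemma maxwellP (X F : state') : V X F <->
  [/\ dom2 F, is_curl0 U X.1 (curl_electric X F) & is_curl U X.2 (curl_magnetic X F)].
Proof.
split=> [[[hF1 hF2] [w [z [uw vz E]]]]|[hF uw vz]].
  have [[hu hw _] _] := uw; have [hv hz _] := vz.
  split; first by split.
    apply: (is_curl0_ae oU _ _ uw); first exact: L2_curl_electric.
    apply: ae_inS E => x [_ Ex]; rewrite curl_electricE Ex.
    move: (mul_field mu X.2 x) => m; apply/matrixP => i j; rewrite !mxE.
    by apply: complex_ext; rewrite !ReImE; ring.
  apply: (is_curl_ae oU _ _ vz); first exact: L2_curl_magnetic.
  apply: ae_inS E => x [Ex _]; rewrite curl_magneticE Ex.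
  move: (mul_field sigma X.1 x) (mul_field eps X.1 x) => m m'.
  by apply/matrixP => i j; rewrite !mxE; apply: complex_ext; rewrite !ReImE; ring.
split => //; exists (curl_electric X F), (curl_magnetic X F); split => //.
apply: aeW => x _; split.
  rewrite curl_magneticE; move: (mul_field sigma X.1 x) (mul_field eps X.1 x) => m m'.
  by apply/matrixP => i j; rewrite !mxE; apply: complex_ext; rewrite !ReImE; ring.
rewrite curl_electricE; move: (mul_field mu X.2 x) => m.
by apply/matrixP => i j; rewrite !mxE; apply: complex_ext; rewrite !ReImE; ring.
Qed.

Lemma mul_field_lin (A : R3 R -> 'M[R]_3) (c : R[i]) (u v : fld) x :
  mul_field A (c *: u + v) x = c *: mul_field A u x + mul_field A v x.
Proof. by rewrite mul_fieldD mul_fieldZ. Qed.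

Lemma maxwell_lin (c : R[i]) X F X' F' : V X F -> V X' F' ->
  V (c *: X + X') (c *: F + F').
Proof.
move=> /maxwellP[hF uw vz].
move=> /maxwellP[hF' uw' vz'].
apply/maxwellP; split.
- by apply: (sip_domD S2) => //; exact: (sip_domZ S2).
- have -> : curl_electric (c *: X + X') (c *: F + F') = c *: curl_electric X F + curl_electric X' F'.
    apply/funext => x; rewrite curl_electricE mul_field_lin.
    transitivity (c *: curl_electric X F x + curl_electric X' F' x) => //.
    transitivity ('i *: (c *: F.2 x + F'.2 x +
      omega *: (c *: mul_field mu X.2 x + mul_field mu X'.2 x))) => //.
    rewrite !curl_electricE.
    exact: scale_lin1.
  exact: (is_curl0_lin oU c uw uw').
have -> : curl_magnetic (c *: X + X') (c *: F + F') = c *: curl_magnetic X F + curl_magnetic X' F'.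
  apply/funext => x; rewrite curl_magneticE !mul_field_lin.
  transitivity (c *: curl_magnetic X F x + curl_magnetic X' F' x) => //.
  transitivity (- 'i *: (c *: F.1 x + F'.1 x +
      ('i *: (c *: mul_field sigma X.1 x + mul_field sigma X'.1 x) +
      omega *: (c *: mul_field eps X.1 x + mul_field eps X'.1 x)))) => //.
  rewrite !curl_magneticE.
  exact: scale_lin2.
exact: (is_curl_lin oU c vz vz').
Qed.

Lemma maxwell_dom X F : V X F -> dom2 X /\ dom2 F.
Proof.
by move=> /maxwellP[hF [[hu _ _] _] [hv _ _]].
Qed.

Lemma maxwell_0 : V 0 0.
Proof.
apply/maxwellP.
have m0 A : mul_field A (0 : fld) = 0.
  by apply/funext => x; rewrite /mul_field mulmx0.
split; first exact: (sip_dom0 S2).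
  rewrite /curl_electric /= m0 !(scaler0, addr0).
  exact: (is_curl0_00 oU).
rewrite /curl_magnetic /= !m0 !(scaler0, addr0).
exact: (is_curl_00 oU).
Qed.

(** The curls prescribed by the equations depend continuously on the state and
    the data, and both curl relations are closed. *)
Lemma maxwell_closed (X_ F_ : nat -> state') X F : (forall n, V (X_ n) (F_ n)) ->
  dom2 X -> dom2 F ->
  nq2 (X_ n - X) @[n --> \oo] --> (0 : R) ->
  nq2 (F_ n - F) @[n --> \oo] --> (0 : R) -> V X F.
Proof.
move=> VXF dX dF cX cF.
have P n := (maxwellP (X_ n) (F_ n)).1 (VXF n).
have dX_ n : dom2 (X_ n) by have [] := maxwell_dom (VXF n).
have dF_ n : dom2 (F_ n) by have [] := maxwell_dom (VXF n).
have comp (Y_ : nat -> state') (Y : state') : (forall n, dom2 (Y_ n)) -> dom2 Y ->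
    nq2 (Y_ n - Y) @[n --> \oo] --> (0 : R) ->
    (nq1 ((Y_ n).1 - Y.1) @[n --> \oo] --> (0 : R)) /\
    (nq1 ((Y_ n).2 - Y.2) @[n --> \oo] --> (0 : R)).
  move=> dY_ dY cY.
  have p1 n : 0 <= nq1 ((Y_ n).1 - Y.1).
    exact: (nq_ge0 S (sip_domB S (dY_ n).1 dY.1)).
  have p2 n : 0 <= nq1 ((Y_ n).2 - Y.2).
    exact: (nq_ge0 S (sip_domB S (dY_ n).2 dY.2)).
  have q1 n : 0 <= nq1 ((Y_ n).1 - Y.1) <= nq2 (Y_ n - Y).
    by rewrite p1 /= nq_pair lerDl; exact: p2.
  have q2 n : 0 <= nq1 ((Y_ n).2 - Y.2) <= nq2 (Y_ n - Y).
    by rewrite p2 /= nq_pair lerDr; exact: p1.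
  split; first exact: (squeeze_cvgr (nearW _ q1) (cvg_cst (0 : R)) cY).
  exact: (squeeze_cvgr (nearW _ q2) (cvg_cst (0 : R)) cY).
have [cX1 cX2] := comp _ _ dX_ dX cX; have [cF1 cF2] := comp _ _ dF_ dF cF.
have dm A (LA : Linfty_mx U A) u (du : L2 U u) := L2_mul_field mU LA du.
apply/maxwellP; split => //.
  have h := fun n => let: And3 _ h _ := P n in h.
  apply: (is_curl0_lim oU h dX.1 (L2_curl_electric dX.2 dF.2) cX1).
  have dmu n := dm _ Lmu _ (dX_ n).2.
  apply: (nq_cvgZ S).
  - move=> n; apply: (sip_domD S (dF_ n).2); exact: (sip_domZ S _ (dmu n)).
  - by apply: (sip_domD S dF.2); exact: (sip_domZ S _ (dm _ Lmu _ dX.2)).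
  apply: (nq_cvgD S) cF2 _.
  - by move=> n; exact: (dF_ n).2.
  - by move=> n; exact: (sip_domZ S _ (dmu n)).
  - exact: dF.2.
  - exact: (sip_domZ S _ (dm _ Lmu _ dX.2)).
  apply: (nq_cvgZ S _ dmu (dm _ Lmu _ dX.2)).
  exact: (cvg_mul_field mU Lmu (fun n => (dX_ n).2) dX.2 cX2).
have h := fun n => let: And3 _ _ h := P n in h.
apply: (is_curl_lim oU h dX.2 (L2_curl_magnetic dX.1 dF.1) cX2).
have de n := dm _ Leps _ (dX_ n).1.
have ds n := dm _ Lsigma _ (dX_ n).1.
have de0 := dm _ Leps _ dX.1; have ds0 := dm _ Lsigma _ dX.1.
have dsum n := sip_domD S (sip_domZ S 'i (ds n)) (sip_domZ S omega (de n)).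
have dsum0 := sip_domD S (sip_domZ S 'i ds0) (sip_domZ S omega de0).
apply: (nq_cvgZ S _ (fun n => sip_domD S (dF_ n).1 (dsum n)) (sip_domD S dF.1 dsum0)).
apply: (nq_cvgD S (fun n => (dF_ n).1) dsum dF.1 dsum0 cF1).
apply: (nq_cvgD S (fun n => sip_domZ S 'i (ds n)) (fun n => sip_domZ S omega (de n))
  (sip_domZ S 'i ds0) (sip_domZ S omega de0)).
  apply: (nq_cvgZ S _ ds ds0).
  exact: (cvg_mul_field mU Lsigma (fun n => (dX_ n).1) dX.1 cX1).
apply: (nq_cvgZ S _ de de0).
exact: (cvg_mul_field mU Leps (fun n => (dX_ n).1) dX.1 cX1).
Qed.

Lemma mul_field0 (A : R3 R -> 'M[R]_3) : mul_field A (0 : fld) = 0.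
Proof. by apply/funext => x; rewrite /mul_field mulmx0. Qed.

Lemma ip_conj_field_l u v : L2 U u -> L2 U v -> ip U (conj_field u) v = ip U (conj_field v) u.
Proof.
move=> hu hv.
rewrite -{1}[v]conj_fieldK (ip_conj_field mU hu (L2_conj_field mU hv)).
by rewrite -(ip_conj mU hu (L2_conj_field mU hv)).
Qed.

Lemma maxwell_magnetic v z : is_curl U v z ->
  V (0, v) ('i *: z, - omega *: mul_field mu v).
Proof.
move=> vz; have [hv hz _] := vz.
have hm := L2_mul_field mU Lmu hv.
split; first by split; [exact: (sip_domZ S _ hz)|exact: (sip_domZ S _ hm)].
exists 0, z; split; [exact: (is_curl0_00 oU)|exact: vz|].
apply: aeW => x _; split.
  transitivity (- 'i *: mul_field sigma (0 : fld) x + 'i *: z x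
    - omega *: mul_field eps (0 : fld) x) => //.
  by rewrite !mul_field0 !scaler0 add0r subr0.
transitivity (- 'i *: (0 : 'cV[R[i]]_3) - omega *: mul_field mu v x) => //.
by rewrite scaler0 add0r -scaleNr.
Qed.

Lemma maxwell_electric u w : is_curl0 U u w ->
  V (u, 0) (- 'i *: mul_field sigma u + - omega *: mul_field eps u, - 'i *: w).
Proof.
move=> uw; have [[hu hw _] _] := uw.
have hs := L2_mul_field mU Lsigma hu; have he := L2_mul_field mU Leps hu.
split.
  split; last exact: (sip_domZ S _ hw).
  exact: (sip_domD S (sip_domZ S _ hs) (sip_domZ S _ he)).
exists w, 0; split; [exact: uw|exact: (is_curl_00 oU)|].
apply: aeW => x _; split.
  transitivity (- 'i *: mul_field sigma u x + 'i *: (0 : 'cV[R[i]]_3)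
    - omega *: mul_field eps u x) => //.
  by rewrite scaler0 addr0 -scaleNr.
transitivity (- 'i *: w x - omega *: mul_field mu (0 : fld) x) => //.
by rewrite mul_field0 scaler0 subr0.
Qed.

(** Complex conjugation and the change of sign in the second component exchange
    V(omega) and its adjoint.  Testing orthogonality with states (0, v), v in
    H(curl), places conj p into the domain of curl_0; testing with (phi, 0),
    phi a test field, gives the weak curl of conj q. *)
Lemma range_complement D : dom2 D ->
  (forall X' F', V X' F' -> sp2 F' D = 0) -> V (conj_field D.1, - conj_field D.2) 0.
Proof.
move=> [hD1 hD2] orth.
have hp := L2_conj_field mU hD1; have hq := L2_conj_field mU hD2; have hq' := sip_domN S hq.
have mN (A : R3 R -> 'M[R]_3) (u : fld) : mul_field A (- u) = - mul_field A u.
  by rewrite -scaleN1r mul_fieldZ scaleN1r.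
have dm A (LA : Linfty_mx U A) u (du : L2 U u) := L2_mul_field mU LA du.
have sym A (LA : Linfty_mx U A) (SA : symmetric_in U A) (u v : fld)
    (hu : L2 U u) (hv : L2 U v) : ip U (mul_field A (conj_field u)) v = ip U (mul_field A (conj_field v)) u.
  rewrite (ip_mul_field_sym mU LA SA (L2_conj_field mU hu) hv) (ip_conj_field_l hu (dm _ LA _ hv)).
  by rewrite mul_field_conj.
apply/maxwellP; split.
- exact: (sip_dom0 S2).
- have hw : L2 U (curl_electric (conj_field D.1, - conj_field D.2) 0).
    exact: (L2_curl_electric (X := (conj_field D.1, - conj_field D.2)) (F := 0) hq' (sip_dom0 S)).
  apply: (is_curl0_of_adjoint oU hp hw) => v z vz; have [hv hz _] := vz.
  have h1 := orth _ _ (maxwell_magnetic (is_curl_conj oU vz)).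
  have hcz := L2_conj_field mU hz; have hcv := L2_conj_field mU hv; have hm := dm _ Lmu _ hcv.
  move: h1; rewrite /psp /= (sip_Zl S 'i hcz hD1) (sip_Zl S (- omega) hm hD2).
  move=> /complement_algebra1 E.
  rewrite (ip_conj_field_l hD1 hz) E /curl_electric /= add0r mN.
  have hmq := dm _ Lmu _ hq.
  rewrite (sip_Zl S 'i (sip_domZ S omega (sip_domN S hmq)) hv).
  rewrite (sip_Zl S omega (sip_domN S hmq) hv) (sip_Nl S hmq hv).
  by rewrite (sym _ Lmu Smu _ _ hD2 hv) !mulrN.
have hz : L2 U (curl_magnetic (conj_field D.1, - conj_field D.2) 0).
  exact: (L2_curl_magnetic (X := (conj_field D.1, - conj_field D.2)) (F := 0) hp (sip_dom0 S)).
split; [exact: hq'|exact: hz|move=> phi t].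
have hphi := L2_test oU t; have hc := L2_curl_test oU t.
have h1 := orth _ _ (maxwell_electric (is_curl0_test oU t)).
have hs := dm _ Lsigma _ hphi; have he := dm _ Leps _ hphi.
have hsp := dm _ Lsigma _ hp; have hep := dm _ Leps _ hp.
have h2 : - 'i * ip U (mul_field sigma (complexify phi)) D.1 +
    - omega * ip U (mul_field eps (complexify phi)) D.1 +
    - 'i * ip U (complexify (classical_curl phi)) D.2 = 0.
  rewrite -[RHS]h1 /psp; congr (_ + _); last exact/esym/(sip_Zl S (- 'i) hc hD2).
  rewrite [RHS](sip_Dl S (sip_domZ S _ hs) (sip_domZ S _ he) hD1).
  congr (_ + _); first exact/esym/(sip_Zl S (- 'i) hs hD1).
  exact/esym/(sip_Zl S (- omega) he hD1).
rewrite (sip_Nl S hq hc) (ip_conj_field_l hD2 hc) complexify_conj.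
rewrite /curl_magnetic /= add0r.
rewrite (sip_Zl S (- 'i) (sip_domD S (sip_domZ S _ hsp) (sip_domZ S _ hep)) hphi).
rewrite (sip_Dl S (sip_domZ S _ hsp) (sip_domZ S _ hep) hphi).
rewrite (sip_Zl S 'i hsp hphi) (sip_Zl S omega hep hphi).
rewrite (sym _ Lsigma Ssigma _ _ hD1 hphi) (sym _ Leps Seps _ _ hD1 hphi) !complexify_conj.
exact: complement_algebra2 h2.
Qed.

Lemma norm_stateE X : dom2 X -> norm_state U X = Num.sqrt (nq2 X).
Proof.
move=> [hu hv]; rewrite nq_pair /nq !Re_ip_self -RintegralD //.
- have := integrable_Re_dotC mU hu hu; apply: eq_integrable => // x _ /=.
  by rewrite sqnormE.
- have := integrable_Re_dotC mU hv hv; apply: eq_integrable => // x _ /=.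
  by rewrite sqnormE.
Qed.

Lemma nq_state_eq0 X : dom2 X -> nq2 X <= 0 ->
  ae_in U (fun x => X.1 x = 0 /\ X.2 x = 0).
Proof.
move=> [hu hv]; rewrite nq_pair => h.
have qu := nq_ge0 S hu; have qv := nq_ge0 S hv.
have u0 : nq1 X.1 = 0 by apply/eqP; rewrite eq_le qu andbT; lra.
have v0 : nq1 X.2 = 0 by apply/eqP; rewrite eq_le qv andbT; lra.
apply: ae_inS2 (Re_ip_self_eq0 mU hu u0) (Re_ip_self_eq0 mU hv v0).
by move=> x -> ->.
Qed.

Lemma maxwell_ae X F F' : V X F' -> dom2 F ->
  ae_in U (fun x => F.1 x = F'.1 x /\ F.2 x = F'.2 x) -> V X F.
Proof.
move=> [_ [w [z [uw vz E]]]] dF FF'; split => //.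
exists w, z; split => //.
by apply: ae_inS2 E FF' => x [<- <-] [-> ->].
Qed.

(** Orthogonal projection onto the closed range leaves a remainder that, by
    [range_complement], produces an element of the kernel, and the lower bound
    makes the kernel trivial. *)
Lemma boundedly_invertible_of_bound (B : R) : 0 <= B ->
  (forall X F, V X F -> nq2 X <= B ^+ 2 * nq2 F) ->
  boundedly_invertible U V /\ (norm_inv U V <= B%:E)%E.
Proof.
move=> B0 bound.
have nq0 : nq2 0 = 0.
  by have := nqZ S2 0 (sip_dom0 S2); rewrite scale0r !ReImE expr0n /= addr0 mul0r.
have ker X : V X 0 -> ae_in U (fun x => X.1 x = 0 /\ X.2 x = 0).
  move=> VX; have [dX _] := maxwell_dom VX.
  by apply: nq_state_eq0 => //; have := bound _ _ VX; rewrite nq0 mulr0.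
have ub : (norm_inv U V <= B%:E)%E.
  apply: ge_ereal_sup => _ [X [F [VXF F1 ->]]].
  have [dX dF] := maxwell_dom VXF.
  have {}F1 : nq2 F <= 1.
    move: F1; rewrite (norm_stateE dF) -{1}sqrtr1 ler_sqrt //; exact: ltr01.
  rewrite lee_fin (norm_stateE dX) -(ger0_norm B0) -sqrtr_sqr ler_wsqrtr //.
  by apply: le_trans (bound _ _ VXF) _; rewrite ler_piMr ?sqr_ge0.
split; last exact: ub.
split; last exact: le_lt_trans ub (ltry _).
- move=> F dF.
  have VC : closed_bounded_below dom2 sp2 V (B ^+ 2).
    split.
    - by move=> X G; exact: maxwell_dom.
    - exact: maxwell_0.
    - by move=> c X G X' G'; exact: maxwell_lin.
    - exact: bound.
    - by move=> X_ G_ X G h dX dG; exact: (maxwell_closed h dX dG).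
  have [X [F0 [VX orth]]] := range_projection S2
    (sip_complete_pair S (sip_complete_L2 mU)) VC dF.
  have [_ dF0] := maxwell_dom VX.
  have dD := sip_domB S2 dF dF0.
  exists X; apply: (maxwell_ae VX dF).
  apply: ae_inS (ker _ (range_complement dD orth)).
  move=> x [k1 k2].
  have cj0 (u v : fld) : conj_field (u - v) x = 0 -> u x = v x.
    move=> /matrixP h; apply/matrixP => i j; have := h i j; rewrite !mxE.
    by move/eqP; rewrite fmorph_eq0 subr_eq0 => /eqP.
  split; first exact: cj0 k1.
  by apply: cj0; apply/eqP; rewrite -oppr_eq0; apply/eqP; exact: k2.
move=> X X' F VX VX'.
have := maxwell_lin (-1) VX' VX.
rewrite scaleN1r scaleN1r addNr => /ker; apply: ae_inS => x [k1 k2].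
by split; apply/eqP; rewrite -subr_eq0 addrC; apply/eqP; [exact: k1|exact: k2].
Qed.

Lemma Im_ip_mul_field_self A u : Linfty_mx U A -> symmetric_in U A -> L2 U u ->
  complex.Im (ip U (mul_field A u) u) = 0.
Proof.
move=> LA SA hu; have hA := L2_mul_field mU LA hu.
have := congr1 (@complex.Im R) (ip_mul_field_sym mU LA SA hu hu).
rewrite (ip_conj mU hA hu) cIm_conj; lra.
Qed.

Lemma curl_magneticK X F : F.1 = 'i *: curl_magnetic X F +
  (- 'i *: mul_field sigma X.1 + - omega *: mul_field eps X.1).
Proof.
apply/funext => x.
transitivity ('i *: curl_magnetic X F x +
  (- 'i *: mul_field sigma X.1 x + - omega *: mul_field eps X.1 x)) => //.
rewrite curl_magneticE.
move: (mul_field sigma X.1 x) (mul_field eps X.1 x) (F.1 x) => m e f.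
rewrite scalerA mulrN i_sqr opprK scale1r !scaleNr -opprD -addrA subrr addr0.
by [].
Qed.

Lemma curl_electricK X F : F.2 = - 'i *: curl_electric X F + - omega *: mul_field mu X.2.
Proof.
apply/funext => x.
transitivity (- 'i *: curl_electric X F x + - omega *: mul_field mu X.2 x) => //.
rewrite curl_electricE; move: (mul_field mu X.2 x) (F.2 x) => m f.
by rewrite scalerA mulNr i_sqr opprK scale1r scaleNr addrK.
Qed.

(** The coefficients are symmetric, so their forms are real, and by duality the
    two curl terms are conjugate to each other up to the factor i. *)
Lemma energy_identities X F : V X F ->
  let s := complex.Re (ip U (mul_field sigma X.1) X.1) in
  let Nu := complex.Re (ip U (mul_field eps X.1) X.1) in
  let Nv := complex.Re (ip U (mul_field mu X.2) X.2) in
  complex.Im (ip U F.1 X.1) + complex.Im (ip U F.2 X.2) =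
    - s - complex.Im omega * (Nu + Nv) /\
  complex.Re (ip U F.1 X.1) - complex.Re (ip U F.2 X.2) =
    - complex.Re omega * (Nu - Nv).
Proof.
move=> VXF s Nu Nv.
have [[hu hv] [hF1 hF2]] := maxwell_dom VXF.
have /maxwellP[_ uw vz] := VXF.
have [[_ hw _] _] := uw; have [_ hz _] := vz.
have hs := L2_mul_field mU Lsigma hu; have he := L2_mul_field mU Leps hu.
have hm := L2_mul_field mU Lmu hv.
have W : ip U (curl_electric X F) X.2 = (ip U (curl_magnetic X F) X.1)^*.
  by rewrite (is_curl0_adjoint uw vz) (ip_conj mU hz hu).
have E1 : ip U F.1 X.1 = 'i * ip U (curl_magnetic X F) X.1 +
    (- 'i * ip U (mul_field sigma X.1) X.1 + - omega * ip U (mul_field eps X.1) X.1).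
  have d1 := sip_domZ S 'i hz; have d2 := sip_domZ S (- 'i) hs.
  have d3 := sip_domZ S (- omega) he.
  rewrite {1}(curl_magneticK X F) (sip_Dl S d1 (sip_domD S d2 d3) hu).
  congr (_ + _); first exact: (sip_Zl S 'i hz hu).
  rewrite (sip_Dl S d2 d3 hu); congr (_ + _); first exact: (sip_Zl S (- 'i) hs hu).
  exact: (sip_Zl S (- omega) he hu).
have E2 : ip U F.2 X.2 = - 'i * ip U (curl_electric X F) X.2 + - omega * ip U (mul_field mu X.2) X.2.
  have d1 := sip_domZ S (- 'i) hw; have d2 := sip_domZ S (- omega) hm.
  rewrite {1}(curl_electricK X F) (sip_Dl S d1 d2 hv).
  congr (_ + _); first exact: (sip_Zl S (- 'i) hw hv).
  exact: (sip_Zl S (- omega) hm hv).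
have s0 := Im_ip_mul_field_self Lsigma Ssigma hu.
have u0 := Im_ip_mul_field_self Leps Seps hu.
have v0 := Im_ip_mul_field_self Lmu Smu hv.
exact: (energy_algebra E1 E2 W s0 u0 v0).
Qed.

Variables (eps_min eps_max mu_min mu_max sigma_max : R).
Hypothesis (eps_min_gt0 : 0 < eps_min) (mu_min_gt0 : 0 < mu_min).
Hypothesis (sigma_max_ge0 : 0 <= sigma_max).
Hypothesis (Beps : form_bounds U eps eps_min eps_max).
Hypothesis (Bmu : form_bounds U mu mu_min mu_max).
Hypothesis (Bsigma : form_bounds U sigma 0 sigma_max).
Let kappa := sigma_max / eps_min.
Let m := Num.min eps_min mu_min.

(** The hypothesis is the scalar inequality that remains to be checked for a
    given omega, once the energy identities are used to express the data terms I
    and D through the forms.  The weights - t + i and t + i on the two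
    components make the twisted inner product equal to I - t D. *)
Lemma pencil_bound (k t : R) : 0 < k ->
  (forall Nu Nv s I D : R, 0 <= Nu -> 0 <= Nv -> 0 <= s -> s <= kappa * Nu ->
    I = - s - complex.Im omega * (Nu + Nv) -> D = - complex.Re omega * (Nu - Nv) ->
    k * (Nu + Nv) <= I - t * D) ->
  forall X F, V X F -> nq2 X <= (1 + t ^+ 2) / (k * m) ^+ 2 * nq2 F.
Proof.
move=> k0 H X F VXF.
have m0 : 0 < m by rewrite lt_min eps_min_gt0.
have [[hu hv] [hF1 hF2]] := maxwell_dom VXF.
have qu := nq_ge0 S hu; have qv := nq_ge0 S hv.
have [s [Nu [Nv [E1 E2 be bm]]]] : exists s Nu Nv : R, [/\
    complex.Im (ip U F.1 X.1) + complex.Im (ip U F.2 X.2) =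
      - s - complex.Im omega * (Nu + Nv),
    complex.Re (ip U F.1 X.1) - complex.Re (ip U F.2 X.2) =
      - complex.Re omega * (Nu - Nv),
    eps_min * nq1 X.1 <= Nu, mu_min * nq1 X.2 <= Nv &
    0 * nq1 X.1 <= s <= sigma_max * nq1 X.1].
  have [E1 E2] := energy_identities VXF.
  have /andP[be _] := form_bounds_ip mU Leps Beps hu.
  have /andP[bm _] := form_bounds_ip mU Lmu Bmu hv.
  have bs := form_bounds_ip mU Lsigma Bsigma hu.
  by eexists; eexists; eexists; split; [exact: E1|exact: E2|exact: be|exact: bm|exact: bs].
rewrite mul0r => /andP[bs0 bs1].
have sN : s <= kappa * Nu.
  apply: (le_trans bs1); rewrite /kappa -mulrA ler_wpM2l //.
  by rewrite mulrC ler_pdivlMr // mulrC.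
have Nu0 : 0 <= Nu by apply: le_trans be; rewrite mulr_ge0 // ltW.
have Nv0 : 0 <= Nv by apply: le_trans bm; rewrite mulr_ge0 // ltW.
have key := H _ _ _ _ _ Nu0 Nv0 bs0 sN E1 E2.
have qXE : nq2 X = nq1 X.1 + nq1 X.2 by exact: nq_pair.
have mN : m * nq2 X <= Nu + Nv.
  rewrite qXE mulrDr lerD //.
    by apply: le_trans be; rewrite ler_wpM2r // ge_min lexx.
  by apply: le_trans bm; rewrite ler_wpM2r // ge_min lexx orbT.
pose Y : state' := (Complex (- t) 1 *: X.1, Complex t 1 *: X.2).
have dY : dom2 Y by split; exact: (sip_domZ S).
have qY : nq2 Y = (1 + t ^+ 2) * nq2 X.
  rewrite nq_pair (nqZ S _ hu) (nqZ S _ hv) /= qXE.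
  by rewrite -/nq1; move: (nq1 X.1) (nq1 X.2) => p q; ring.
have rE : complex.Re (sp2 F Y) =
    complex.Im (ip U F.1 X.1) + complex.Im (ip U F.2 X.2) -
    t * (complex.Re (ip U F.1 X.1) - complex.Re (ip U F.2 X.2)).
  rewrite /psp (sip_Zr S _ hF1 hu) (sip_Zr S _ hF2 hv).
  exact: Re_twisted_sum.
have cs := cauchy_schwarz S2 (conj hF1 hF2 : dom2 F) dY.
rewrite qY in cs.
apply: (square_bound (r := complex.Re (sp2 F Y))) => //.
- exact: mulr_gt0.
- exact: (nq_ge0 S2 (conj hu hv : dom2 X)).
- exact: (nq_ge0 S2 (conj hF1 hF2 : dom2 F)).
- rewrite rE; apply: le_trans key; rewrite -mulrA ler_wpM2l //; exact: ltW.
- by apply: (le_trans cs); rewrite mulrCA mulrA.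
Qed.

End MaxwellPencil.

(** * The resolvent bounds *)

(** The bounds are compared at one point, with the first basis vector. *)
Lemma form_bounds_le (R : realType) (U : set (R3 R)) (A : R3 R -> 'M[R]_3) (lo hi : R) :
  open U -> U !=set0 -> form_bounds U A lo hi -> lo <= hi.
Proof.
move=> oU U0 /(ae_in_witness oU U0)[x [_ /(_ (delta_mx 0 0))]].
rewrite sum3 !mxE /= expr1n !expr0n /= !addr0 => /(_ erefl) /andP[].
exact: le_trans.
Qed.

Theorem theorem2p3 (R : realType) (Omega : set (R * R * R))
  (eps mu sigma : R * R * R -> 'M[R]_3)
  (eps_min eps_max mu_min mu_max sigma_max : R)
  (hOmega : lipschitz_domain Omega)
  (Leps : Linfty_mx Omega eps)
  (Lmu : Linfty_mx Omega mu)
  (Lsigma : Linfty_mx Omega sigma)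
  (Seps : symmetric_in Omega eps)
  (Smu : symmetric_in Omega mu)
  (Ssigma : symmetric_in Omega sigma)
  (eps_min_gt0 : 0 < eps_min)
  (mu_min_gt0 : 0 < mu_min)
  (Beps : form_bounds Omega eps eps_min eps_max)
  (Bmu : form_bounds Omega mu mu_min mu_max)
  (Bsigma : form_bounds Omega sigma 0 sigma_max) :
  let kappa := sigma_max / eps_min in
  let V := maxwell Omega eps mu sigma in
  let bound1 (omega : R[i]) : R :=
    1 / (`|complex.Im omega| - 1 / 2 * kappa)
    * (1 + (1 / 2 * kappa) ^+ 2 / complex.Re omega ^+ 2) in
  let bound2 (omega : R[i]) : R := 1 / (`|complex.Im omega| - kappa) in
  (forall omega : R[i],
     complex.Re omega != 0 -> complex.Im omega < - (1 / 2 * kappa) ->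
     boundedly_invertible Omega (V omega) /\
     (norm_inv Omega (V omega) <=
       (1 / Num.min eps_min mu_min * bound1 omega)%:E)%E) /\
  (forall omega : R[i],
     complex.Im omega < - kappa ->
     boundedly_invertible Omega (V omega) /\
     (norm_inv Omega (V omega) <=
       (1 / Num.min eps_min mu_min)%:E *
       Order.min (if (complex.Re omega == 0)%R then +oo else (bound1 omega)%:E)
                 (bound2 omega)%:E)%E).
Proof.
move=> kappa V bound1 bound2.
have [oU _ U0 _] := hOmega.
(* kappa >= 0, because the bounds on sigma hold at some point of Omega *)
have sigma_max_ge0 : 0 <= sigma_max := form_bounds_le oU U0 Bsigma.
have kappa0 : 0 <= kappa by rewrite divr_ge0 // ltW.
set m := Num.min eps_min mu_min.
have m0 : 0 < m by rewrite lt_min eps_min_gt0.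
have main (omega : R[i]) (k t : R) : 0 < k ->
    (forall Nu Nv s : R, 0 <= Nu -> 0 <= Nv -> 0 <= s -> s <= kappa * Nu ->
      k * (Nu + Nv) <= - s - complex.Im omega * (Nu + Nv)
                       - t * (- complex.Re omega * (Nu - Nv))) ->
    boundedly_invertible Omega (V omega) /\
    (norm_inv Omega (V omega) <= (1 / m * (1 / k * (1 + t ^+ 2)))%:E)%E.
  move=> k0 H.
  have t0 : 0 <= t ^+ 2 := sqr_ge0 t.
  have mi : 0 < 1 / m by rewrite divr_gt0.
  have ki : 0 < 1 / k by rewrite divr_gt0.
  apply: (boundedly_invertible_of_bound oU Leps Lmu Lsigma Seps Smu Ssigma).
    apply: mulr_ge0; [exact: ltW|apply: mulr_ge0; [exact: ltW|lra]].
  move=> X F VXF.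
  have /= [dX [dF1 dF2]] := maxwell_dom oU Leps Lmu Lsigma VXF.
  have qF : 0 <= nq (psp (ip Omega)) F.
    exact: (nq_ge0 (semi_inner_product_pair (semi_inner_product_L2 (open_measurable3 oU)))
      (conj dF1 dF2)).
  apply: le_trans (pencil_bound oU Leps Lmu Lsigma Seps Smu Ssigma eps_min_gt0
    mu_min_gt0 sigma_max_ge0 Beps Bmu Bsigma k0 _ VXF) _.
    by move=> Nu Nv s I D Nu0 Nv0 s0 sN -> ->; exact: H.
  apply: ler_wpM2r => //.
  (* the step from sqrt (1 + t^2) to 1 + t^2, squared *)
  have -> : (1 / m * (1 / k * (1 + t ^+ 2))) ^+ 2 =
      (1 + t ^+ 2) / (k * m) ^+ 2 * (1 + t ^+ 2).
    by field; rewrite (lt0r_neq0 k0) (lt0r_neq0 m0).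
  by rewrite ler_peMr ?divr_ge0 ?exprn_ge0 ?addr_ge0 ?lerDl // mulr_ge0 // ltW.
have part1 (omega : R[i]) : complex.Re omega != 0 -> complex.Im omega < - (1 / 2 * kappa) ->
    boundedly_invertible Omega (V omega) /\
    (norm_inv Omega (V omega) <= (1 / m * bound1 omega)%:E)%E.
  move=> a0 b0.
  have bE : `|complex.Im omega| = - complex.Im omega.
    by rewrite ltr0_norm //; apply: lt_le_trans b0 _; lra.
  have k0 : 0 < `|complex.Im omega| - 1 / 2 * kappa by rewrite bE; lra.
  (* the twist is t = kappa / (2 Re omega) *)
  rewrite /bound1 -expr_div_n.
  apply: main k0 _ => Nu Nv s Nu0 Nv0 s0 sN.
  have -> : 1 / 2 * kappa / complex.Re omega * (- complex.Re omega * (Nu - Nv)) =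
      - (1 / 2 * (kappa * Nu - kappa * Nv)) by field.
  rewrite bE; lra.
have part2 (omega : R[i]) : complex.Im omega < - kappa ->
    boundedly_invertible Omega (V omega) /\
    (norm_inv Omega (V omega) <= (1 / m * bound2 omega)%:E)%E.
  move=> b0.
  have bE : `|complex.Im omega| = - complex.Im omega.
    by rewrite ltr0_norm //; apply: lt_le_trans b0 _; lra.
  have k0 : 0 < `|complex.Im omega| - kappa by rewrite bE; lra.
  have := @main omega _ 0 k0; rewrite expr0n addr0 mulr1; apply.
  move=> Nu Nv s Nu0 Nv0 s0 sN; rewrite mul0r subr0 bE.
  have := mulr_ge0 kappa0 Nv0; lra.
split=> // omega b0; have [inv le2] := part2 omega b0; split => //.
case: ifPn => [_|a0].
  by rewrite min_r ?leey // -EFinM.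
have [_ le1] : boundedly_invertible Omega (V omega) /\
    (norm_inv Omega (V omega) <= (1 / m * bound1 omega)%:E)%E.
  by apply: part1 => //; lra.
by rewrite /Order.min; case: ifP => _; rewrite -EFinM.
Qed.
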